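(* Let $\mathcal X$ be a finite type cluster $\mathcal X$-variety and $l\in\mathcal X(\mathbb Z^t)$. Let $\mathbf i$ be a non-negative seed for $l$, and let $\mathbf j(l)\subset\mathbf i$ be the zero subseed for $l$. Let $\mathbf i'$ be another non-negative seed for $l$. Then the seeds $\mathbf i$ and $\mathbf i'$ are $\mathbf j(l)$-equivalent.
   Context: A seed $\mathbf i=(I,\varepsilon,d)$ consists of a finite set $I$, an integer valued function $\varepsilon=(\varepsilon_{ij})$ on $I\times I$ and positive integers $\{d_i\}_{i\in I}$ with greatest common divisor $1$ such that $\varepsilon_{ij}d_j^{-1}$ is skew-symmetric; there are no frozen elements. The mutated seed $\mu_k(\mathbf i)=(I,\varepsilon',d)$, $k\in I$, is given by $\varepsilon'_{ij}=-\varepsilon_{ij}$ if $k\in\{i,j\}$; $\varepsilon'_{ij}=\varepsilon_{ij}$ if $k\notin\{i,j\}$ and $\varepsilon_{ik}\varepsilon_{kj}\le 0$; $\varepsilon'_{ij}=\varepsilon_{ij}+|\varepsilon_{ik}|\varepsilon_{kj}$ if $k\notin\{i,j\}$ and $\varepsilon_{ik}\varepsilon_{kj}>0$. Mutations act on cluster coordinates by $$X'_k=X_k^{-1},\quad X'_i=X_i(1+X_k^{-\mathrm{sgn}(\varepsilon_{ik})})^{-\varepsilon_{ik}}\ (i\ne k);\qquad A_kA'_k=\prod_{\varepsilon_{kj}>0}A_j^{\varepsilon_{kj}}+\prod_{\varepsilon_{kj}<0}A_j^{-\varepsilon_{kj}},\quad A'_i=A_i\ (i\neq k).$$ Seed isomorphisms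 act by relabelling. All seeds considered are related to a given one by a cluster transformation (a composition of mutations and seed isomorphisms). Seeds connected by a cluster transformation acting, up to relabelling, as the identity on all cluster coordinates are identified; finite type means that there are finitely many seeds after this identification. A point $l\in\mathcal X(\mathbb Z^t)$ (with values in the tropical semifield $\mathbb Z^t$: $\mathbb Z$ with multiplication $a+b$ and addition $\max(a,b)$) has integer coordinates $\{x_i\}$ for each seed, arbitrary for one seed and transforming under mutations by $x'_k=-x_k$, $x'_i=x_i-\varepsilon_{ik}\max(0,-\mathrm{sgn}(\varepsilon_{ik})x_k)$ for $i\neq k$. A seed $\mathbf i$ is non-negative for $l$ if all coordinates $x_i(l)$ at $\mathbf i$ are $\geq0$. A subset of vertices of $\mathbf i$ gives a subseed $\mathbf j\subset\mathbf i$. Mutating $\mathbf i$ at a vertex of $\mathbf j$ one gets a new seed with a subseed canonically identified (on the level of vertices) with $\mathbf j$; one can mutate again at its vertices, and so on. The seeds so obtained are called $\mathbf j$-equivalent to $\mathbf i$. The zero subseed $\mathbf j(l)\subset\mathbf i$ is given by the set of vertices $i$ with $x_i(l)=0$. *)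

(* Defs.v *)
From mathcomp Require Import all_boot all_order all_algebra.
From mathcomp Require Import mpoly.
From mathcomp Require Import ring.

Set Implicit Arguments.
Unset Strict Implicit.
Unset Printing Implicit Defensive.

Import Order.TTheory GRing.Theory Num.Theory.
Local Open Scope ring_scope.

Definition skew_symmetrizable (I : finType) (e : I -> I -> int) (d : I -> nat) :=
  forall i j, (e i j)%:Q / (d j)%:R = - ((e j i)%:Q / (d i)%:R) :> rat.

Record seed := Seed {
  vertex :> finType;
  exch : vertex -> vertex -> int;
  mult : vertex -> nat;
  mult_gt0 : forall i, (0 < mult i)%N;
  mult_gcd : \big[gcdn/0%N]_i mult i = 1%N;
  exch_skew : skew_symmetrizable exch mult
}.

Definition mutate_exch (I : finType) (e : I -> I -> int) (k i j : I) : int :=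
  if (k == i) || (k == j) then - e i j
  else if e i k * e k j <= 0 then e i j
  else e i j + `|e i k| * e k j.

Lemma mutate_exch_skew (s : seed) (k : s) :
  skew_symmetrizable (mutate_exch (@exch s) k) (@mult s).
Proof.
move=> i j; rewrite /mutate_exch orbC.
case: ifP => _; first by rewrite !rmorphN !mulNr (exch_skew i j).
have dn0 (l : s) : (mult l)%:R != 0 :> rat by rewrite pnatr_eq0 -lt0n mult_gt0.
have dp (l : s) : 0 < (mult l)%:R :> rat by rewrite ltr0n mult_gt0.
have E (a b : s) : (exch a b)%:Q = - ((exch b a)%:Q * (mult b)%:R / (mult a)%:R).
  by rewrite mulrAC -mulNr -(exch_skew a b) divfK.
have sgn : (exch i k * exch k j <= 0) = (exch j k * exch k i <= 0).
  rewrite -!(ler_int rat) !rmorphM /= (E i k) (E k j).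
  have -> : - ((exch k i)%:Q * (mult k)%:R / (mult i)%:R) *
      - ((exch j k)%:Q * (mult j)%:R / (mult k)%:R) =
      (exch j k)%:Q * (exch k i)%:Q * ((mult j)%:R / (mult i)%:R) :> rat.
    by field; rewrite !dn0.
  by rewrite pmulr_lle0 // divr_gt0.
rewrite -sgn; case: ifPn => [_|]; first exact: exch_skew.
rewrite sgn -ltNge => pos.
rewrite !rmorphD !rmorphM /= !mulrDl opprD; congr (_ + _).
  exact: exch_skew.
have Ei : `|exch i k|%:Q = `|exch k i|%:Q * (mult k)%:R / (mult i)%:R.
  rewrite !intr_norm (E i k) normrN [LHS]normrM normrM normfV.
  by rewrite (gtr0_norm (dp k)) (gtr0_norm (dp i)).
have nn : `|exch k i|%:Q * (exch j k)%:Q = `|exch j k|%:Q * (exch k i)%:Q.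
  rewrite -!rmorphM /=; congr (_%:~R).
  have [p|n|z] := ltrgt0P (exch k i); last by rewrite z mulr0 ltxx in pos.
    by move: pos; rewrite pmulr_lgt0 // => /gtr0_norm ->; rewrite mulrC.
  by move: pos; rewrite nmulr_lgt0 // => /ltr0_norm ->; ring.
rewrite Ei (E k j) -nn.
by field; rewrite !dn0.
Qed.

Definition mutate (s : seed) (k : s) : seed :=
  Seed (@mult_gt0 s) (mult_gcd s) (@mutate_exch_skew s k).

Record seed_iso (s t : seed) := SeedIso {
  iso_fun :> s -> t;
  iso_inv : t -> s;
  iso_funK : cancel iso_fun iso_inv;
  iso_invK : cancel iso_inv iso_fun;
  iso_exch : forall i j, exch (iso_fun i) (iso_fun j) = exch i j;
  iso_mult : forall i, mult (iso_fun i) = mult i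
}.

Inductive cluster_transformation (s : seed) : seed -> Type :=
| ct_id : cluster_transformation s s
| ct_mutate (t : seed) (k : t) :
    cluster_transformation s t -> cluster_transformation s (mutate k)
| ct_iso (t u : seed) (f : seed_iso t u) :
    cluster_transformation s t -> cluster_transformation s u.

(* The field Q(z_i : i a vertex of s), used both for the X- and the
   A-coordinates of the seed s. *)
Definition ratfun (s : seed) := {fraction {mpoly rat[#|s|]}}.

Definition ratvar (s : seed) (i : s) : ratfun s := tofrac 'X_(enum_rank i).

Section Mutations.
Variables (t : seed) (k : t).

Definition mutate_X (F : fieldType) (X : t -> F) (i : t) : F :=
  if i == k then (X k)^-1
  else X i * (1 + X k ^ (- sgz (exch i k))) ^ (- exch i k).

Definition mutate_A (F : fieldType) (A : t -> F) (i : t) : F :=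
  if i == k then
    (\prod_(j | 0 < exch k j) A j ^ exch k j +
     \prod_(j | exch k j < 0) A j ^ (- exch k j)) / A k
  else A i.

Definition mutate_trop (x : t -> int) (i : t) : int :=
  if i == k then - x k
  else x i - exch i k * Num.max 0 (- sgz (exch i k) * x k).

End Mutations.

(* The coordinates of the target seed of a cluster transformation, pulled back
   to rational functions of the coordinates of its source. *)
Fixpoint X_coord (s t : seed) (c : cluster_transformation s t) :
    t -> ratfun s :=
  match c with
  | ct_id => @ratvar s
  | ct_mutate _ k c => mutate_X k (X_coord c)
  | ct_iso _ _ f c => fun i => X_coord c (iso_inv f i)
  end.

Fixpoint A_coord (s t : seed) (c : cluster_transformation s t) :
    t -> ratfun s :=
  match c with
  | ct_id => @ratvar s
  | ct_mutate _ k c => mutate_A k (A_coord c)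
  | ct_iso _ _ f c => fun i => A_coord c (iso_inv f i)
  end.

(* A seed of the cluster variety of s: a seed together with the cluster
   transformation relating it to s. *)
Record cluster_seed (s : seed) := ClusterSeed {
  cseed :> seed;
  ctrans : cluster_transformation s cseed
}.

(* The cluster transformation p -> q over s is, up to the relabelling f, the
   identity on all cluster coordinates. As coordinates are compared after
   pulling them back to s, no inverse of ctrans p is needed. *)
Definition identified (s : seed) (p q : cluster_seed s) : Prop :=
  exists f : seed_iso p q,
    (forall i, X_coord (ctrans q) (f i) = X_coord (ctrans p) i) /\
    (forall i, A_coord (ctrans q) (f i) = A_coord (ctrans p) i).

Definition finite_type (s : seed) : Prop :=
  exists (n : nat) (q : 'I_n -> cluster_seed s),
    forall p, exists m, identified (q m) p.

(* A point of X(Z^t), given by its coordinates at s, which are arbitrary. *)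
Definition tropical_point (s : seed) := s -> int.

Fixpoint trop_coord (s t : seed) (c : cluster_transformation s t)
    (l : tropical_point s) : t -> int :=
  match c with
  | ct_id => l
  | ct_mutate _ k c => mutate_trop k (trop_coord c l)
  | ct_iso _ _ f c => fun i => trop_coord c l (iso_inv f i)
  end.

Definition non_negative (s : seed) (l : tropical_point s)
    (p : cluster_seed s) : Prop :=
  forall i : p, 0 <= trop_coord (ctrans p) l i.

(* A subseed is given by its set of vertices. *)
Definition zero_subseed (s : seed) (l : tropical_point s)
    (p : cluster_seed s) : {set p} :=
  [set i | trop_coord (ctrans p) l i == 0].

(* Relies on mutate k and t having convertible vertex types. *)
Fixpoint mutate_along (s t : seed) (c : cluster_transformation s t)
    (ks : seq t) : cluster_seed s :=
  match ks with
  | [::] => ClusterSeed c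
  | k :: ks' => @mutate_along s (mutate k) (ct_mutate k c) ks'
  end.

Definition subseed_equivalent (s : seed) (p : cluster_seed s) (J : {set p})
    (q : cluster_seed s) : Prop :=
  exists ks : seq p,
    {subset ks <= J} /\ identified (mutate_along (ctrans p) ks) q.

(* Main.v *)
Require Import Defs.
From mathcomp Require Import all_boot all_order all_algebra.
From mathcomp Require Import perm mpoly.
From mathcomp Require Import ring zify.
From Stdlib Require Import Classical Relation_Operators.

(** Fix a tropical point [l] and pair it with the point of the cluster variety where
    all [A]-coordinates of the base seed are [1]: to a seed [r] attach the positive
    rational [height l r], the product of the [A_i ^ (d_i * x_i(l))] over its vertices.
    A mutation at [k] multiplies it by a power of [1 + X], [X > 0], with exponent
    [- d_k * x_k(l)] ([height_mut]). So the height strictly rises when [x_k < 0], falls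
    when [x_k > 0] and stays put when [x_k = 0]; the non-negative seeds are the ones
    from which it cannot rise. The height depends only on the seed up to
    identification: its [A]-values do obviously, and its tropical coordinates are the
    growth rates of the [X]-coordinates along a curve ([X_coord_grows], [grows_inj]).
    In finite type there are finitely many heights, and ascending terminates.

    The theorem says that the end of an ascent is unique modulo mutations at
    vertices with [x_k = 0]. By Newman's lemma modulo an equivalence
    ([maximal_conn]) it is enough to resolve local forks: mutations at [f] and [g]
    starting from a seed where [x_f, x_g <= 0], not both [0]. In finite type the
    exchange numbers of [f] and [g] are those of A1 x A1, A2, B2 or G2, since otherwise
    some tropical point would have heights descending forever along an alternating
    path ([exch_dynkin2]). Then alternating mutations close up after 4, 5, 6 or 8 steps
    ([alt_seed_period]), and the signs of the tropical coordinates met on the way show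
    that on this polygon the height is minimal at the starting seed only, or at the two
    ends of a level edge through it ([polygon_heights]); so the fork can be resolved by
    going around the other way.

    The closing of the polygon concerns all coordinates, not only those at [f] and [g].
    At [f] and [g] it is a finite computation ([trop_period], [y_period]). Elsewhere,
    exchange matrix entries and [X]-coordinates change by increments that telescope:
    up to a multiple, they are differences of a discrete Wronskian of periodic
    sequences ([pairing_period], [cocycle_period]). The [A]-coordinates are covered by
    the same statement, because monomials in the [A]-coordinates, with exponents
    mutated like rows of the exchange matrix, behave like [X]-coordinates
    ([monomial_mutate]); this last identity also gives the change of the height. *)

Set Implicit Arguments.
Unset Strict Implicit.
Unset Printing Implicit Defensive.

Import Order.TTheory GRing.Theory Num.Theory.
Local Open Scope ring_scope.

(** * Confluence modulo an equivalence *)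

Section ConfluenceModulo.
Variables (T : Type) (rho : T -> nat) (B : nat) (U E : T -> T -> Prop).

Inductive conn (P : T -> Prop) : T -> T -> Prop :=
| conn_refl a : P a -> conn P a a
| conn_sym a b : conn P a b -> conn P b a
| conn_trans a b c : conn P a b -> conn P b c -> conn P a c
| conn_up a b : P a -> P b -> U a b -> conn P a b
| conn_level a b : P a -> P b -> E a b -> conn P a b.

Local Notation Es := (clos_refl_trans_1n T E).

Inductive ascends : T -> T -> Prop :=
| ascends_refl a : ascends a a
| ascends_up a b c : U a b -> ascends b c -> ascends a c
| ascends_level a b c : E a b -> ascends b c -> ascends a c.

(** A property of the whole level class: no level path opens a way up. *)
Definition maximal p := forall p' b, Es p p' -> ~ U p' b.

Hypothesis rho_bound : forall a, (rho a <= B)%N.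
Hypothesis U_rho : forall a b, U a b -> (rho a < rho b)%N.
Hypothesis E_rho : forall a b, E a b -> rho a = rho b.
Hypothesis E_sym : forall a b, E a b -> E b a.

Definition above m (x : T) := (m < rho x)%N.

(** The two local forks, an edge up against an edge up or against a level edge; both
    are to be resolved strictly above their common source. *)
Hypothesis peak : forall r a b, U r a -> U r b -> conn (above (rho r)) a b.
Hypothesis cross : forall r a b, U r a -> E r b ->
  exists2 c, U b c & conn (above (rho r)) a c.

Lemma Es_trans a b c : Es a b -> Es b c -> Es a c.
Proof. by elim=> // x y z xy _ IH /IH; apply: rt1n_trans. Qed.

Lemma Es_sym a b : Es a b -> Es b a.
Proof.
elim=> [x|x y z xy _ zy]; first exact: rt1n_refl.
apply: Es_trans zy _; apply: rt1n_trans (E_sym xy) _; exact: rt1n_refl.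
Qed.

Lemma ascends_Es a b c : Es a b -> ascends b c -> ascends a c.
Proof. by elim=> // x y z xy _ IH /IH; apply: ascends_level. Qed.

Lemma ascendsP a p : ascends a p ->
  Es a p \/ exists r b, [/\ Es a r, U r b & ascends b p].
Proof.
elim=> [x|x y z xy yz _|x y z xy yz [IH|[r [b [yr rb bz]]]]].
- by left; apply: rt1n_refl.
- by right; exists x, y; split=> //; apply: rt1n_refl.
- by left; apply: rt1n_trans IH.
- by right; exists r, b; split=> //; apply: rt1n_trans yr.
Qed.

Lemma exists_maximal a : exists2 p, ascends a p & maximal p.
Proof.
have [k] := ubnP (B - rho a)%N; elim: k a => // k IH a ak.
have [|] := classic (maximal a); first by exists a => //; apply: ascends_refl.
move=> /not_all_ex_not [r /not_all_ex_not [b nU]].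
have [ar /NNPP rb] := imply_to_and _ _ nU.
have eqr : rho a = rho r by elim: ar => // x y z /E_rho -> _ ->.
have [|p bp mp] := IH b.
  by have := U_rho rb; have := rho_bound b; lia.
by exists p => //; apply: ascends_Es ar _; apply: ascends_up bp.
Qed.

Definition unique_top r := forall p q,
  ascends r p -> maximal p -> ascends r q -> maximal q -> Es p q.

Lemma conn_unique_top (P : T -> Prop) a b :
  (forall x, P x -> unique_top x) -> conn P a b ->
  forall p q, ascends a p -> maximal p -> ascends b q -> maximal q -> Es p q.
Proof.
move=> uP; elim=> {a b} [a /uP|a b _ IH|a b c _ IH1 _ IH2|a b Pa Pb ab|a b Pa Pb ab].
- exact.
- by move=> p q ap mp bq mq; apply: Es_sym; apply: IH.
- move=> p q ap mp bq mq; have [w bw mw] := exists_maximal b.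
  exact: Es_trans (IH1 _ _ ap mp bw mw) (IH2 _ _ bw mw bq mq).
- move=> p q ap mp bq mq; apply: (uP a) => //; exact: ascends_up bq.
- move=> p q ap mp bq mq; apply: (uP a) => //; exact: ascends_level bq.
Qed.

Lemma lift_up a r b : Es a r -> U r b ->
  exists2 c, U a c & conn (above (rho a)) c b.
Proof.
elim=> [x|x y z xy _ IH] => [xb|/IH [c yc cb]].
  by exists b => //; apply/conn_refl/U_rho.
have [d xd cd] := cross yc (E_sym xy).
exists d => //; rewrite (E_rho xy).
exact: conn_trans (conn_sym cd) cb.
Qed.

(** Newman's argument: two ascents from [r] are moved along the level edges
    until both leave [r] itself; their first steps are then connected above [r],
    where uniqueness is known by induction on the distance to the bound. *)
Lemma unique_topP r : unique_top r.
Proof.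
have [k] := ubnP (B - rho r)%N; elim: k r => // k IH r rk.
have IHr x : above (rho r) x -> unique_top x.
  by move=> rx; apply: IH; have := rho_bound x; rewrite /above in rx *; lia.
move=> p q /ascendsP [rp|[r1 [a [rr1 r1a ap]]]] mp
  /ascendsP [rq|[r2 [b [rr2 r2b bq]]]] mq.
- exact: Es_trans (Es_sym rp) rq.
- by case: (mp r2 b) => //; apply: Es_trans rr2; apply: Es_sym.
- by case: (mq r1 a) => //; apply: Es_trans rr1; apply: Es_sym.
have [c rc ca] := lift_up rr1 r1a; have [d rd db] := lift_up rr2 r2b.
have ab : conn (above (rho r)) a b.
  by apply: conn_trans (conn_sym ca) _; apply: conn_trans db; apply: peak.
exact: (conn_unique_top IHr ab).
Qed.

Theorem maximal_conn p q : conn (fun=> True) p q ->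
  maximal p -> maximal q -> Es p q.
Proof.
move=> pq mp mq; apply: (conn_unique_top _ pq) => // [x _||].
- exact: unique_topP.
- exact: ascends_refl.
- exact: ascends_refl.
Qed.

End ConfluenceModulo.
(** * Rank two recurrences *)

Definition ppart (u : int) : int := Num.max u 0.

Lemma ppart_id u : 0 <= u -> ppart u = u.
Proof. by move=> u0; apply: max_l. Qed.

Lemma ppart_eq0 u : u <= 0 -> ppart u = 0.
Proof. by move=> u0; apply: max_r. Qed.

Definition alt (T : Type) (x y : T) (t : nat) : T := if odd t then y else x.

(** The finite rank two types, with the number of steps after which an
    alternating sequence of mutations returns to its start. *)
Variant dynkin2 : int -> int -> nat -> Prop :=
| A1A1 : dynkin2 0 0 4
| A2 : dynkin2 1 1 5
| B2 : dynkin2 1 2 6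
| C2 : dynkin2 2 1 6
| G2 : dynkin2 1 3 8
| G2' : dynkin2 3 1 8.

(** The common recurrence of tropical coordinates, of rows and (up to sign) of columns
    of the exchange matrix at the two vertices mutated in turn. *)
Definition trop_rec (k u : nat -> int) :=
  forall t, u t.+2 + u t = k t * ppart (u t.+1).

Definition periodic2 (T : Type) (u : nat -> T) N := u N = u 0%N /\ u N.+1 = u 1%N.

Lemma trop_period k0 k1 N u :
  dynkin2 k0 k1 N -> trop_rec (alt k0 k1) u -> periodic2 u N.
Proof.
move=> ty urec.
have := (urec 0, urec 1, urec 2, urec 3)%N.
have := (urec 4, urec 5, urec 6, urec 7)%N.
rewrite /ppart /periodic2.
case: ty urec => _; rewrite /alt /= => - [[[h4 h5] h6] h7] [[[h0 h1] h2] h3].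
- lia.
- lia.
- lia.
- lia.
- lia.
- lia.
Qed.

Lemma dynkin2_sym k0 k1 N : dynkin2 k0 k1 N -> dynkin2 k1 k0 N.
Proof. by case; constructor. Qed.

Lemma dynkin2_alt k0 k1 N : dynkin2 k0 k1 N -> alt k0 k1 N = k0.
Proof. by case. Qed.

Lemma dynkin2_odd k0 k1 N : dynkin2 k0 k1 N -> odd N -> k0 = 1 /\ k1 = 1.
Proof. by case. Qed.

Lemma dynkin2_cases k0 k1 N : dynkin2 k0 k1 N ->
  [/\ k0 = 0, k1 = 0 & N = 4%N] \/ exists2 n : nat, k0 * k1 = n & n \in [:: 1; 2; 3]%N.
Proof.
by case; [left|right; exists 1%N|right; exists 2%N|right; exists 2%N
  |right; exists 3%N|right; exists 3%N].
Qed.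

(** For [k0 * k1 <> 0], the increments of [w] multiplied by [k0 * k1] are the
    differences of the discrete Wronskian [W] of the two recurrent sequences, which
    is periodic because they are. For [A1 x A1] steps two apart cancel. *)
Lemma pairing_period k0 k1 N (u g w : nat -> int) : dynkin2 k0 k1 N ->
  trop_rec (alt k0 k1) u -> trop_rec (alt k1 k0) (fun t => - g t) ->
  (forall t, w t.+1 = w t + (ppart (u t.+1) * g t.+1 + u t.+1 * ppart (- g t.+1))) ->
  w N = w 0%N.
Proof.
move=> ty urec grec wrec.
have [[? ? ?]|[c kc c3]] := dynkin2_cases ty.
  subst; move: (urec 0%N) (urec 1%N) (urec 2%N) (grec 0%N) (grec 1%N) (grec 2%N).
  rewrite /alt /= !mul0r => u2 u3 u4 g2 g3 g4.
  have [eu3 eu4] : u 3%N = - u 1%N /\ u 4%N = - u 2%N by split; lia.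
  have [eg3 eg4] : g 3%N = - g 1%N /\ g 4%N = - g 2%N by split; lia.
  have cancel2 (x y : int) :
      ppart x * y + x * ppart (- y) + (ppart (- x) * (- y) + (- x) * ppart (- - y)) = 0.
    have E (v : int) : ppart v = v + ppart (- v) by rewrite /ppart; lia.
    by rewrite opprK (E x) (E y); ring.
  rewrite !wrec eu3 eu4 eg3 eg4.
  rewrite -[RHS]addr0 -(cancel2 (u 1%N) (g 1%N)).
  by rewrite -[RHS]addr0 -(cancel2 (u 2%N) (g 2%N)); ring.
have [/oppr_inj gN /oppr_inj gSN] := trop_period (dynkin2_sym ty) grec.
have [uN uSN] := trop_period ty urec.
pose W t := alt k0 k1 t * (u t.+1 * g t) - alt k1 k0 t * (u t * g t.+1).
have step t : k0 * k1 * (w t.+1 - w t) = W t.+1 - W t.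
  have -> : k0 * k1 = alt k0 k1 t * alt k1 k0 t.
    by rewrite /alt; case: ifP => // _; rewrite mulrC.
  rewrite wrec /W.
  have -> : alt k0 k1 t.+1 = alt k1 k0 t by rewrite /alt /=; case: (odd t).
  have -> : alt k1 k0 t.+1 = alt k0 k1 t by rewrite /alt /=; case: (odd t).
  have := urec t; have := grec t.
  move: (ppart (u _)) (ppart (- g _)) (alt _ _ _) (alt _ _ _) => p q a b e1 e2.
  transitivity (b * g t.+1 * (a * p) + a * u t.+1 * (b * q)); last first.
    by rewrite -e1 -e2; ring.
  ring.
have WN : W N = W 0%N.
  by rewrite /W uN uSN gN gSN (dynkin2_alt ty) (dynkin2_alt (dynkin2_sym ty)).
have : k0 * k1 * (w N - w 0%N) = W N - W 0%N.
  elim: (N) => [|t IH]; first by ring.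
  by rewrite -[w t.+1](subrK (w t)) -addrA mulrDr step IH; ring.
rewrite WN subrr kc => /eqP; rewrite mulf_eq0 subr_eq0 => /orP[/eqP c0|/eqP //].
by move: c3; rewrite (_ : c = 0%N) //; lia.
Qed.


(** The elements on which subtraction-free formulas are safe: they form a
    semifield avoiding [0]. *)
Record pos_cone (F : fieldType) (pos : F -> Prop) : Prop := PosCone {
  pos1 : pos 1;
  posD : forall x y, pos x -> pos y -> pos (x + y);
  posM : forall x y, pos x -> pos y -> pos (x * y);
  posV : forall x, pos x -> pos x^-1;
  pos_neq0 : forall x, pos x -> x != 0
}.

Section PosCone.
Variables (F : fieldType) (pos : F -> Prop) (posP : pos_cone pos).

Lemma pos_expz x (n : int) : pos x -> pos (x ^ n).
Proof.
move=> px; have pX m : pos (x ^+ m).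
  by elim: m => [|m IH]; rewrite ?expr0 ?exprS; [apply: pos1|apply: posM].
by case: n => n; [apply: pX|apply: (posV posP); apply: pX].
Qed.

Lemma pos_prod (I : finType) (P : pred I) (f : I -> F) :
  (forall i, P i -> pos (f i)) -> pos (\prod_(i | P i) f i).
Proof. by move=> pf; apply: big_ind => //; [apply: (pos1 posP)|apply: (posM posP)]. Qed.

Lemma pos_1D x : pos x -> pos (1 + x).
Proof. exact: (posD posP (pos1 posP)). Qed.

Lemma pos_unit_expz x (n : int) : pos x -> x ^ n != 0.
Proof. by move=> px; apply/(pos_neq0 posP)/pos_expz. Qed.

(** The Y-system obeyed by the [X]-coordinates at the two vertices. *)
Definition y_rec (k : nat -> int) (Y : nat -> F) :=
  forall t, Y t.+2 * Y t = (1 + Y t.+1) ^ k t.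

(** Prepending one term exchanges the two exponents, so that the types [B2] and
    [C2], and likewise the two versions of [G2], need a single computation. *)
Lemma y_period_shift k0 k1 N Y : (forall t, pos (Y t)) ->
  odd N = false ->
  (forall Z, (forall t, pos (Z t)) -> y_rec (alt k0 k1) Z -> periodic2 Z N) ->
  y_rec (alt k1 k0) Y -> periodic2 Y N.
Proof.
case: N => // N pY oN perZ Yrec.
(* Prolongs [Y] by the term that the recurrence prescribes before [Y 0]. *)
pose Z t := if t is t'.+1 then Y t' else (1 + Y 0%N) ^ k0 / Y 1%N.
have nY t : Y t != 0 by apply: (pos_neq0 posP).
have [||ZN ZSN] := perZ Z.
- case=> [|t] /=; last exact: pY.
  by apply: (posM posP); [apply/pos_expz/pos_1D|apply: (posV posP)].
- case=> [|t] /=; first by rewrite mulrC divfK.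
  by rewrite Yrec /alt /=; case: (odd t).
split=> //; apply: (mulIf (nY N)).
move: ZN ZSN => /= YN YSN; rewrite Yrec YSN YN /alt.
by move: oN => /= /negbFE ->; rewrite mulrC divfK.
Qed.

(** The periodicity of the rank two Y-systems: the closed forms of the successive
    terms are verified one at a time, so that each check stays small. *)
Lemma y_period k0 k1 N Y : dynkin2 k0 k1 N -> (forall t, pos (Y t)) ->
  y_rec (alt k0 k1) Y -> periodic2 Y N.
Proof.
have next Z (n : nat) t : (forall t, pos (Z t)) ->
    Z t.+2 * Z t = (1 + Z t.+1) ^ n ->
    forall v, v * Z t = (1 + Z t.+1) ^+ n -> Z t.+2 = v.
  move=> pZ Zrec v vE; apply: (mulIf (pos_neq0 posP (pZ t))).
  by rewrite Zrec vE exprnP.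
have perB Z : (forall t, pos (Z t)) -> y_rec (alt 1 2) Z -> periodic2 Z 6.
  move=> pZ Zrec; have := (pZ 0%N, pZ 1%N).
  have := (next _ _ _ pZ (Zrec 0%N), next _ _ _ pZ (Zrec 1%N),
    next _ _ _ pZ (Zrec 2%N), next _ _ _ pZ (Zrec 3%N),
    next _ _ _ pZ (Zrec 4%N), next _ _ _ pZ (Zrec 5%N)).
  rewrite /periodic2.
  move: (Z 0%N) (Z 1%N) (Z 2%N) (Z 3%N) (Z 4%N) (Z 5%N) (Z 6%N) (Z 7%N).
  move=> x y z2 z3 z4 z5 z6 z7 [[[[[e2 e3] e4] e5] e6] e7] [px py].
  have nx := pos_neq0 posP px; have ny := pos_neq0 posP py.
  have n1 := pos_neq0 posP (pos_1D px); have n2 := pos_neq0 posP (pos_1D py).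
  have n3 : 1 + y + x != 0 by apply/(pos_neq0 posP)/(posD posP) => //; apply: pos_1D.
  have {}e2 : z2 = (1 + y) / x by apply: e2; field; rewrite nx.
  have {}e3 : z3 = (1 + y + x) ^+ 2 / (x ^+ 2 * y).
    by apply: e3; rewrite e2; field; rewrite nx ny.
  have {}e4 : z4 = ((1 + x) ^+ 2 + y) / (x * y).
    by apply: e4; rewrite e2 e3; field; rewrite nx ny.
  have {}e5 : z5 = (1 + x) ^+ 2 / y.
    by apply: e5; rewrite e3 e4; field; rewrite nx ny.
  have {}e6 : z6 = x.
    by apply: e6; rewrite e4 e5; field; rewrite nx ny.
  split=> //; apply: e7; rewrite e5 e6; field; by rewrite ny.
have perG Z : (forall t, pos (Z t)) -> y_rec (alt 1 3) Z -> periodic2 Z 8.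
  move=> pZ Zrec; have := (pZ 0%N, pZ 1%N).
  have := (next _ _ _ pZ (Zrec 0%N), next _ _ _ pZ (Zrec 1%N),
    next _ _ _ pZ (Zrec 2%N), next _ _ _ pZ (Zrec 3%N),
    next _ _ _ pZ (Zrec 4%N), next _ _ _ pZ (Zrec 5%N),
    next _ _ _ pZ (Zrec 6%N), next _ _ _ pZ (Zrec 7%N)).
  rewrite /periodic2.
  move: (Z 0%N) (Z 1%N) (Z 2%N) (Z 3%N) (Z 4%N) (Z 5%N) (Z 6%N) (Z 7%N) (Z 8%N) (Z 9%N).
  move=> x y z2 z3 z4 z5 z6 z7 z8 z9 [[[[[[[e2 e3] e4] e5] e6] e7] e8] e9] [px py].
  have nx := pos_neq0 posP px; have ny := pos_neq0 posP py.
  have {}e2 : z2 = (1 + y) / x by apply: e2; field; rewrite nx.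
  have {}e3 : z3 = (1 + y + x) ^+ 3 / (x ^+ 3 * y).
    by apply: e3; rewrite e2; field; rewrite nx ny.
  have {}e4 : z4 = (x ^+ 3 + 3 * x ^+ 2 + 3 * x * (1 + y) + (1 + y) ^+ 2) / (x ^+ 2 * y).
    by apply: e4; rewrite e2 e3; field; rewrite nx ny.
  have {}e5 : z5 = ((1 + x) ^+ 2 + y) ^+ 3 / (x ^+ 3 * y ^+ 2).
    by apply: e5; rewrite e3 e4; field; rewrite nx ny.
  have {}e6 : z6 = ((1 + x) ^+ 3 + y) / (x * y).
    by apply: e6; rewrite e4 e5; field; rewrite nx ny.
  have {}e7 : z7 = (1 + x) ^+ 3 / y.
    by apply: e7; rewrite e5 e6; field; rewrite nx ny.
  have {}e8 : z8 = x.
    by apply: e8; rewrite e6 e7; field; rewrite nx ny.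
  split=> //; apply: e9; rewrite e7 e8; field; by rewrite ny.
case=> pY Yrec; last 4 first.
- exact: perB.
- exact: (y_period_shift pY _ perB Yrec).
- exact: perG.
- exact: (y_period_shift pY _ perG Yrec).
- have e t : Y t.+2 * Y t = 1 by rewrite Yrec /alt; case: ifP.
  have e4 t : Y t.+4 = Y t.
    apply: (mulIf (pos_neq0 posP (pY t.+2))).
    by rewrite e mulrC e.
  by split; apply: e4.
have := (pY 0%N, pY 1%N).
have := (next _ _ _ pY (Yrec 0%N), next _ _ _ pY (Yrec 1%N),
  next _ _ _ pY (Yrec 2%N), next _ _ _ pY (Yrec 3%N),
  next _ _ _ pY (Yrec 4%N)).
rewrite /periodic2.
move: (Y 0%N) (Y 1%N) (Y 2%N) (Y 3%N) (Y 4%N) (Y 5%N) (Y 6%N).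
move=> x y z2 z3 z4 z5 z6 [[[[e2 e3] e4] e5] e6] [px py].
have nx := pos_neq0 posP px; have ny := pos_neq0 posP py.
have {}e2 : z2 = (1 + y) / x by apply: e2; field; rewrite nx.
have {}e3 : z3 = (1 + y + x) / (x * y).
  by apply: e3; rewrite e2; field; rewrite nx ny.
have {}e4 : z4 = (1 + x) / y.
  by apply: e4; rewrite e2 e3; field; rewrite nx ny.
have {}e5 : z5 = x.
  by apply: e5; rewrite e3 e4; field; rewrite nx ny.
by split=> //; apply: e6; rewrite e4 e5; field; rewrite ny.
Qed.

Lemma pos_torsion n z : n \in [:: 1; 2; 3]%N -> pos z -> z ^+ n = 1 -> z = 1.
Proof.
move=> n3 pz zn; apply/eqP; rewrite -subr_eq0; apply/eqP.
have pz2 := pos_neq0 posP (pos_1D pz).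
have pz3 : 1 + z + z * z != 0.
  by apply/(pos_neq0 posP)/(posD posP); [apply: pos_1D|apply: (posM posP)].
move: n3 zn; rewrite !inE => /or3P[] /eqP-> zn.
- by rewrite -zn expr1 subrr.
- have : (z - 1) * (1 + z) = z ^+ 2 - 1 by ring.
  by rewrite zn subrr => z2; apply: (mulIf pz2); rewrite mul0r.
- have : (z - 1) * (1 + z + z * z) = z ^+ 3 - 1 by ring.
  by rewrite zn subrr => z3; apply: (mulIf pz3); rewrite mul0r.
Qed.

(** This form of the factor, where the sign of [u] occurs in an exponent only, is the
    one that telescopes. *)
Lemma mutation_factor (y : F) (u : int) : pos y ->
  (1 + y ^ (- sgz u)) ^ (- u) = (1 + y) ^ (- u) * y ^ ppart u.
Proof.
move=> py; have ny := pos_neq0 posP py.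
have n1y := pos_neq0 posP (pos_1D py).
rewrite /ppart; case: (ltrgt0P u) => [u0|u0|->].
- have -> : sgz u = 1 by rewrite gtr0_sgz.
  rewrite !exprN1.
  have -> : 1 + y^-1 = (1 + y) / y by field.
  by rewrite expfzMl exprz_inv opprK.
- have -> : sgz u = -1 by rewrite ltr0_sgz.
  by rewrite opprK expr1z expr0z mulr1.
- by rewrite oppr0 !expr0z mulr1.
Qed.

(** The multiplicative form of [pairing_period]; the final root extraction is
    unique on positive elements. *)
Lemma cocycle_period k0 k1 N u (Y z : nat -> F) : dynkin2 k0 k1 N ->
  trop_rec (alt k0 k1) u -> (forall t, pos (Y t)) -> y_rec (alt k1 k0) Y ->
  z 0%N != 0 ->
  (forall t, z t.+1 = z t * (1 + Y t.+1 ^ (- sgz (u t.+1))) ^ (- u t.+1)) ->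
  z N = z 0%N.
Proof.
move=> ty urec pY Yrec z0 zrec.
have {}zrec t : z t.+1 = z t * ((1 + Y t.+1) ^ (- u t.+1) * Y t.+1 ^ ppart (u t.+1)).
  by rewrite zrec mutation_factor.
pose f t := (1 + Y t) ^ (- u t) * Y t ^ ppart (u t).
have pf t : pos (f t) by apply: (posM posP); apply/pos_expz => //; apply/pos_1D.
have nY t (n : int) := pos_unit_expz n (pY t).
have nY1 t (n : int) := pos_unit_expz n (pos_1D (pY t)).
have nY' t := pos_neq0 posP (pY t).
have nY1' t := pos_neq0 posP (pos_1D (pY t)).
have [[? ? ?]|[c kc c3]] := dynkin2_cases ty.
  subst; move: (urec 1%N) (urec 2%N) (Yrec 1%N) (Yrec 2%N).
  rewrite /alt /= !mul0r !expr0z => u3 u4 Y3 Y4.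
  have cancel2 t : u t.+2 + u t = 0 -> Y t.+2 * Y t = 1 -> f t * f t.+2 = 1.
    move=> ut Yt; rewrite /f.
    have -> : u t.+2 = - u t by lia.
    have -> : Y t.+2 = (Y t)^-1 by apply: (mulIf (nY' t)); rewrite Yt mulVf.
    have -> : 1 + (Y t)^-1 = (1 + Y t) / Y t by field; apply: nY'.
    have -> : ppart (u t) = u t + ppart (- u t) by rewrite /ppart; lia.
    rewrite opprK expfzMl !exprz_inv expfzDr ?nY' // -!invr_expz.
    by field; rewrite !nY !nY1.
  rewrite !zrec -!/(f _).
  transitivity (z 0%N * ((f 1%N * f 3%N) * (f 2%N * f 4%N))); first by ring.
  by rewrite !cancel2 // !mulr1.
have [YN YSN] := y_period (dynkin2_sym ty) pY Yrec.
have [uN uSN] := trop_period ty urec.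
(* The multiplicative Wronskian of [u] and [Y]. *)
pose V t := Y t ^ (alt k0 k1 t * u t.+1) / Y t.+1 ^ (alt k1 k0 t * u t).
have step t : f t.+1 ^ (k0 * k1) = V t.+1 / V t.
  have -> : k0 * k1 = alt k0 k1 t * alt k1 k0 t.
    by rewrite /alt; case: ifP => // _; rewrite mulrC.
  rewrite /V /f.
  have -> : alt k0 k1 t.+1 = alt k1 k0 t by rewrite /alt /=; case: (odd t).
  have -> : alt k1 k0 t.+1 = alt k0 k1 t by rewrite /alt /=; case: (odd t).
  have := urec t; have := Yrec t.
  move: (ppart (u _)) (alt k0 k1 t) (alt k1 k0 t) => p a b Yt ut.
  rewrite expfzMl.
  have -> : ((1 + Y t.+1) ^ (- u t.+1)) ^ (a * b) = (Y t.+2 * Y t) ^ (- (a * u t.+1)).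
    by rewrite Yt !exprz_exp; congr (_ ^ _); ring.
  have -> : (Y t.+1 ^ p) ^ (a * b) = Y t.+1 ^ (b * u t.+2) * Y t.+1 ^ (b * u t).
    by rewrite -expfzDr // -mulrDr ut !exprz_exp; congr (_ ^ _); ring.
  rewrite expfzMl -!invr_expz.
  by field; rewrite !nY.
have VN : V N = V 0%N.
  by rewrite /V uN uSN YN YSN (dynkin2_alt ty) (dynkin2_alt (dynkin2_sym ty)).
have nV t : V t != 0 by rewrite /V mulf_neq0 ?invr_neq0.
have prodf t : exists2 q, pos q & z t = z 0%N * q /\ q ^ (k0 * k1) = V t / V 0%N.
  elim: t => [|t [q pq [zt qV]]].
    by exists 1; [apply: (pos1 posP)|rewrite mulr1 exp1rz divff].
  exists (q * f t.+1); first exact: (posM posP).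
  by rewrite zrec zt mulrA expfzMl qV step; split=> //; field; rewrite !nV.
have [q pq [-> ]] := prodf N; rewrite VN divff // kc => qc.
by rewrite (pos_torsion c3 pq qc) mulr1.
Qed.

End PosCone.

(** * Mutation of data indexed by a fixed set *)

(** The rule by which the rows of the exchange matrix change, away from the mutated
    vertex, makes sense for any row of integers. The integers [d_i * x_i] of a
    tropical point follow it too, and basis vectors mutated by it keep track of
    the [A]-coordinates. *)
Definition mutate_row (I : eqType) (ek : I -> int) (k : I) (n : I -> int) j : int :=
  if j == k then - n j
  else if n k * ek j <= 0 then n j else n j + `|n k| * ek j.

Lemma mutate_rowE (I : eqType) (ek : I -> int) k (n : I -> int) j : j != k ->
  mutate_row ek k n j = n j + (ppart (n k) * ek j + n k * ppart (- ek j)).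
Proof.
rewrite /mutate_row => /negPf ->.
have [n0|n0|->] := ltrgt0P (n k); last by rewrite !mul0r lexx !addr0.
  rewrite pmulr_rle0 // (ppart_id (ltW n0)); case: (ltrgt0P (ek j)) => [e0|e0|->].
  - by rewrite (ppart_eq0 (u := - _)) ?mulr0 ?addr0 // oppr_le0 ltW.
  - by rewrite ppart_id ?mulrN ?addrN ?addr0 // oppr_ge0 ltW.
  - by rewrite oppr0 ppart_id // !mulr0 !addr0.
rewrite nmulr_rle0 // (ppart_eq0 (ltW n0)) mul0r add0r.
case: (ltrgt0P (ek j)) => [e0|e0|->].
- by rewrite ppart_eq0 ?mulr0 ?addr0 // oppr_le0 ltW.
- by rewrite ppart_id ?mulrN ?mulNr // oppr_ge0 ltW.
- by rewrite oppr0 ppart_id // mulr0 addr0.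
Qed.

Lemma mutate_exch_row (I : finType) (e : I -> I -> int) k i j : i != k ->
  mutate_exch e k i j = mutate_row (e k) k (e i) j.
Proof. by rewrite /mutate_exch /mutate_row ![k == _]eq_sym => /negPf ->. Qed.

Record cdata (I : finType) (F : fieldType) := CData {
  dE : I -> I -> int;
  dX : I -> F;
  dA : I -> F
}.

Definition mutate_data (I : finType) (F : fieldType) (D : cdata I F) (k : I) :=
  CData (mutate_exch (dE D) k)
    (fun i => if i == k then (dX D k)^-1
      else dX D i * (1 + dX D k ^ (- sgz (dE D i k))) ^ (- dE D i k))
    (fun i => if i == k then
        (\prod_(j | 0 < dE D k j) dA D j ^ dE D k j +
         \prod_(j | dE D k j < 0) dA D j ^ (- dE D k j)) / dA D k
      else dA D i).

(** These monomials mutate as the [X]-coordinates do ([hatX_mutate]). *)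
Definition hatX (I : finType) (F : fieldType) (e : I -> I -> int) (A : I -> F) i :=
  \prod_j A j ^ e i j.

Definition hat (I : finType) (F : fieldType) (D : cdata I F) :=
  CData (dE D) (hatX (dE D) (dA D)) (dA D).

Section DataMutation.
Variables (I : finType) (F : fieldType) (pos : F -> Prop) (posP : pos_cone pos).
Implicit Types (D : cdata I F) (n : I -> int).

Lemma pos_mutate_X D k : (forall i, pos (dX D i)) ->
  forall i, pos (dX (mutate_data D k) i).
Proof.
move=> pX i /=; case: ifP => _; first exact: (posV posP).
by apply: (posM posP) => //; apply/(pos_expz posP)/(pos_1D posP)/(pos_expz posP).
Qed.

Lemma pos_mutate_A D k : (forall i, pos (dA D i)) ->
  forall i, pos (dA (mutate_data D k) i).
Proof.
move=> pA i /=; case: ifP => // _; apply: (posM posP); last exact: (posV posP).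
by apply: (posD posP); apply: (pos_prod posP) => j _; apply: (pos_expz posP).
Qed.

Lemma pos_hatX e (A : I -> F) i : (forall j, pos (A j)) -> pos (hatX e A i).
Proof. by move=> pA; apply: (pos_prod posP) => j _; apply: (pos_expz posP). Qed.

Lemma prod_expz (P : pred I) (f : I -> F) (m : int) :
  (\prod_(i | P i) f i) ^ m = \prod_(i | P i) f i ^ m.
Proof.
exact: (big_morph (fun x : F => x ^ m) (fun x y => expfzMl x y m) (exp1rz _ m)).
Qed.

(** Writing the exchange relation as [A_k A'_k = M (1 + X)], with [M] its second
    monomial and [X] the monomial [hatX] at [k], leaves an identity between
    exponents. *)
Lemma monomial_mutate D k n : (forall i, pos (dA D i)) -> dE D k k = 0 ->
  let X := hatX (dE D) (dA D) k in
  \prod_j dA (mutate_data D k) j ^ mutate_row (dE D k) k n j =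
  (\prod_j dA D j ^ n j) * (1 + X ^ (- sgz (n k))) ^ (- n k).
Proof.
move=> pA ekk X; have pX : pos X := pos_hatX _ _ pA.
rewrite (mutation_factor posP _ pX).
have nA j := pos_neq0 posP (pA j).
have XE : X = \prod_(j | j != k) dA D j ^ dE D k j.
  by rewrite /X /hatX (bigD1 k) //= ekk expr0z mul1r.
pose M := \prod_(j | j != k) dA D j ^ ppart (- dE D k j).
have nM : M != 0.
  by apply: (pos_neq0 posP); apply: (pos_prod posP) => j _; apply: (pos_expz posP).
have ME : \prod_(j | dE D k j < 0) dA D j ^ (- dE D k j) = M.
  rewrite /M big_mkcond /= [RHS]big_mkcond; apply: eq_bigr => j _ /=.
  case: eqVneq => [->|_] /=; first by rewrite ekk ltxx.
  case: ltrP => e0; first by rewrite ppart_id // oppr_ge0 ltW.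
  by rewrite ppart_eq0 ?expr0z // oppr_le0.
have PE : \prod_(j | 0 < dE D k j) dA D j ^ dE D k j = M * X.
  rewrite XE /M -big_split /= big_mkcond /= [RHS]big_mkcond; apply: eq_bigr => j _.
  case: eqVneq => [->|_] /=; first by rewrite ekk ltxx.
  rewrite -expfzDr //; case: ltrP => e0.
    by rewrite ppart_eq0 ?add0r // oppr_le0 ltW.
  by rewrite ppart_id ?addNr ?expr0z // oppr_ge0.
have nX1 := pos_neq0 posP (pos_1D posP pX); have nX := pos_neq0 posP pX.
rewrite (bigD1 k) //= eqxx PE ME {1}/mutate_row eqxx.
rewrite [in RHS](bigD1 k) //=.
have -> : (M * X + M) / dA D k = M * (1 + X) / dA D k by congr (_ / _); ring.
have -> : \prod_(j | j != k) (if j == k then M * (1 + X) / dA D k else dA D j) ^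
    mutate_row (dE D k) k n j =
    (\prod_(j | j != k) dA D j ^ n j) * (X ^ ppart (n k) * M ^ n k).
  rewrite XE /M !prod_expz -!big_split /=; apply: eq_bigr => j jk.
  rewrite (negPf jk) mutate_rowE // !expfzDr // !exprz_exp.
  by rewrite [dE D k j * _]mulrC [ppart (- _) * _]mulrC.
rewrite !expfzMl exprz_inv opprK -(invr_expz M).
by field; apply: expfz_neq0.
Qed.

Lemma hatX_mutate D k i : (forall i, pos (dA D i)) -> dE D k k = 0 ->
  hatX (dE (mutate_data D k)) (dA (mutate_data D k)) i = dX (mutate_data (hat D) k) i.
Proof.
move=> pA ekk; rewrite [RHS]/= /hatX; have [->|ik] := eqVneq i k.
  rewrite -prodfV; apply: eq_bigr => j _ /=.
  rewrite /mutate_exch eqxx /= invr_expz; case: eqVneq => // ->.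
  by rewrite ekk oppr0 !expr0z.
rewrite -monomial_mutate //; apply: eq_bigr => j _.
by rewrite /= mutate_exch_row.
Qed.

Lemma mutate_exchK (e : I -> I -> int) k i j :
  mutate_exch (mutate_exch e k) k i j = e i j.
Proof.
rewrite /mutate_exch; have [/orP h|/norP[/negPf ki /negPf kj]] := boolP (_ || _).
  by rewrite opprK.
rewrite !eqxx ki kj /= mulrNN normrN.
case: (leP _ 0) => _ //; by ring.
Qed.

Lemma mutate_X_twice D k i : (forall j, pos (dX D j)) ->
  dX (mutate_data (mutate_data D k) k) i = dX D i.
Proof.
move=> pX; rewrite /= eqxx invrK; case: (eqVneq i k) => [->//|_].
rewrite /mutate_exch eqxx orbT opprK sgzN opprK exprz_inv -mulrA -[RHS]mulr1.
have nf : 1 + dX D k ^ (- sgz (dE D i k)) != 0.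
  by apply/(pos_neq0 posP)/(pos_1D posP)/(pos_expz posP).
by rewrite -expfzDr ?addNr ?expr0z.
Qed.

Lemma mutate_A_twice D k i : (forall j, pos (dA D j)) -> dE D k k = 0 ->
  dA (mutate_data (mutate_data D k) k) i = dA D i.
Proof.
move=> pA ekk; rewrite /= eqxx; case: (eqVneq i k) => [->|//].
have -> : \prod_(j | 0 < mutate_exch (dE D) k k j)
      (if j == k then (\prod_(j | 0 < dE D k j) dA D j ^ dE D k j +
         \prod_(j | dE D k j < 0) dA D j ^ (- dE D k j)) / dA D k
       else dA D j) ^ mutate_exch (dE D) k k j =
   \prod_(j | dE D k j < 0) dA D j ^ (- dE D k j).
  apply: eq_big => j; rewrite /mutate_exch eqxx /= ?oppr_gt0 //.
  by case: eqVneq => [->|//]; rewrite ekk ltxx.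
have -> : \prod_(j | mutate_exch (dE D) k k j < 0)
      (if j == k then (\prod_(j | 0 < dE D k j) dA D j ^ dE D k j +
         \prod_(j | dE D k j < 0) dA D j ^ (- dE D k j)) / dA D k
       else dA D j) ^ (- mutate_exch (dE D) k k j) =
   \prod_(j | 0 < dE D k j) dA D j ^ dE D k j.
  apply: eq_big => j; rewrite /mutate_exch eqxx /= ?oppr_lt0 ?opprK //.
  by case: eqVneq => [->|//]; rewrite ekk ltxx.
have nA := pos_neq0 posP (pA k).
set P := \prod_(j | 0 < dE D k j) _; set M := \prod_(j | dE D k j < 0) _.
have nPM : P + M != 0.
  apply/(pos_neq0 posP)/(posD posP); apply: (pos_prod posP) => j _.
  - exact: (pos_expz posP).
  - exact: (pos_expz posP).
by rewrite addrC; field; rewrite nA nPM.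
Qed.

End DataMutation.

(** * Alternating mutations at two vertices *)

Fixpoint alt_data (I : finType) (F : fieldType) (D : cdata I F) (f g : I) t :=
  if t is t'.+1 then mutate_data (alt_data D f g t') (alt f g t') else D.

Fixpoint alt_row (I : finType) (F : fieldType) (D : cdata I F) (f g : I)
    (n : I -> int) t :=
  if t is t'.+1 then
    let k := alt f g t' in mutate_row (dE (alt_data D f g t') k) k (alt_row D f g n t')
  else n.

(** What remains after [N] steps: the identity, or the exchange of the two vertices
    for the pentagon. *)
Definition alt_perm (I : finType) (f g : I) (N : nat) (i : I) : I :=
  if odd N then tperm f g i else i.

Section Alternating.
Variables (I : finType) (F : fieldType).
Variables (D : cdata I F) (f g : I).
Hypothesis fg : f != g.
Hypothesis fg_ge0 : 0 <= dE D f g.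
Hypothesis gf_le0 : dE D g f <= 0.

Let v t := alt f g t.
Let E t := dE (alt_data D f g t).
Let k0 := dE D f g.
Let k1 := - dE D g f.

Lemma alt_succ2 (T : Type) (x y : T) t : alt x y t.+2 = alt x y t.
Proof. by rewrite /alt /= negbK. Qed.

Lemma alt_swap (T : Type) (x y : T) t : alt x y t.+1 = alt y x t.
Proof. by rewrite /alt /=; case: (odd t). Qed.

Lemma alt_neq t : v t.+1 != v t.
Proof. by rewrite /v /alt /=; case: (odd t) => //=; rewrite eq_sym. Qed.

(** The two exchange numbers change sign at every step, but so does the role of the
    two vertices. *)
Lemma alt_exch t : E t (v t) (v t.+1) = alt k0 k1 t /\ E t (v t.+1) (v t) = - alt k1 k0 t.
Proof.
elim: t => [|t [IH1 IH2]]; first by rewrite /alt /= /k1 opprK.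
rewrite /E /= /mutate_exch /= -/(E _) -/(v t).
rewrite [v t.+2]alt_succ2 -/(v t) !eqxx ?orbT /=.
by rewrite IH1 IH2 !alt_swap opprK.
Qed.

Lemma alt_ge0 t : 0 <= alt k0 k1 t.
Proof. by rewrite /alt; case: ifP; rewrite // oppr_ge0. Qed.

Lemma alt_exch_diag : dE D f f = 0 -> dE D g g = 0 -> forall t x,
  x \in [:: f; g] -> E t x x = 0.
Proof.
move=> ff gg; elim=> [|t IH] x xfg.
  by move: xfg; rewrite !inE => /orP[] /eqP->.
rewrite /E /= /mutate_exch -/(E t) -/(v t) !IH //.
have [e1 e2] := alt_exch t.
case: eqVneq => //= vx; have {vx} -> : x = v t.+1.
  move: xfg vx; rewrite !inE /v /alt /=.
  by case: (odd t) => /orP[] /eqP-> //=; rewrite eqxx.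
rewrite e1 e2 ifT // mulNr oppr_le0 mulr_ge0 ?alt_ge0 //.
by rewrite -alt_swap alt_ge0.
Qed.

Lemma mem_alt t : v t \in [:: f; g].
Proof. by rewrite !inE /v /alt; case: ifP; rewrite eqxx ?orbT. Qed.

(** Value at the vertex about to be mutated. Starting one step early, with the
    sign flip that a mutation would have caused, makes the recurrence hold from
    the beginning. *)
Definition row_seq (n : I -> int) t :=
  if t is t'.+1 then alt_row D f g n t' (v t') else - n g.

Lemma row_prev n t : alt_row D f g n t (v t.+1) = - row_seq n t.
Proof.
case: t => [|t]; first by rewrite /= opprK.
by rewrite /= [v t.+2]alt_succ2 /mutate_row eqxx.
Qed.

Lemma row_rec n : trop_rec (alt k0 k1) (row_seq n).
Proof.
move=> t; have [e1 _] := alt_exch t.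
rewrite /= mutate_rowE ?alt_neq // row_prev -/(E t) -/(v t) e1.
by rewrite (ppart_eq0 (u := - _)) ?oppr_le0 ?alt_ge0 //; ring.
Qed.

Definition col_seq j t := if t is t'.+1 then E t' (v t') j else - dE D g j.

Lemma col_prev j t : E t (v t.+1) j = - col_seq j t.
Proof.
case: t => [|t]; first by rewrite /= opprK.
by rewrite [v t.+2]alt_succ2 /= /E /= /mutate_exch -/(v t) eqxx.
Qed.

Lemma col_rec j : j \notin [:: f; g] ->
  trop_rec (alt k1 k0) (fun t => - col_seq j t).
Proof.
move=> jfg t; have [_ e2] := alt_exch t; have jv s : j != v s.
  by apply: contraNneq jfg => ->; apply: mem_alt.
have := col_prev j t; rewrite /= => ep.
rewrite [E t.+1 _ _]/E /= mutate_exch_row ?alt_neq // mutate_rowE -/(v t) // -/(E t).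
rewrite e2 ep ppart_eq0; last by rewrite oppr_le0 -alt_swap alt_ge0.
by ring.
Qed.

Variable N : nat.
Hypothesis ty : dynkin2 k0 k1 N.

Lemma alt_perm_alt (T : Type) (P : I -> T -> Prop) x y :
  P (v N) x -> P (v N.+1) y -> P (alt_perm f g N f) x /\ P (alt_perm f g N g) y.
Proof.
rewrite /v /alt /alt_perm /=; case: (odd N) => //=.
by rewrite tpermL tpermR.
Qed.

Lemma alt_perm_out j : j \notin [:: f; g] -> alt_perm f g N j = j.
Proof.
rewrite !inE negb_or /alt_perm => /andP[jf jg]; case: ifP => // _.
by rewrite tpermD // eq_sym.
Qed.

Lemma alt_perm_bij : bijective (alt_perm f g N).
Proof.
by exists (alt_perm f g N) => x; rewrite /alt_perm; case: (odd N); rewrite ?tpermK.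
Qed.

Lemma alt_permP j : [\/ j = f, j = g | j \notin [:: f; g]].
Proof.
rewrite !inE; case: eqVneq => [->|_]; first by apply: Or31.
by case: eqVneq => [->|_]; [apply: Or32|apply: Or33].
Qed.

Lemma alt_row_period n j : alt_row D f g n N (alt_perm f g N j) = n j.
Proof.
have [uN uSN] := trop_period ty (row_rec n).
have [ef eg] : alt_row D f g n N (alt_perm f g N f) = n f /\
    alt_row D f g n N (alt_perm f g N g) = n g.
  apply: (alt_perm_alt (P := fun w x => alt_row D f g n N w = x)).
    exact: uSN.
  by rewrite row_prev uN /= opprK.
have [->|->|jfg] := alt_permP j => //.
rewrite alt_perm_out //.
have jv s : j != v s by apply: contraNneq jfg => ->; apply: mem_alt.
apply: (pairing_period (w := fun t => alt_row D f g n t j) ty (row_rec n) (col_rec jfg)).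
by move=> t /=; rewrite mutate_rowE.
Qed.

Lemma alt_exch_out i t j : i \notin [:: f; g] ->
  E t i j = alt_row D f g (dE D i) t j.
Proof.
move=> ifg; have iv s : i != v s by apply: contraNneq ifg => ->; apply: mem_alt.
elim: t j => // t IH j; rewrite /E /= mutate_exch_row ?iv // -/(E t) -/(v t).
by rewrite /mutate_row !IH.
Qed.

Lemma alt_exch_period i j : dE D f f = 0 -> dE D g g = 0 ->
  E N (alt_perm f g N i) (alt_perm f g N j) = dE D i j.
Proof.
move=> ff gg; have [ifg|ifg] := boolP (i \in [:: f; g]); last first.
  by rewrite (alt_perm_out ifg) alt_exch_out // alt_row_period.
have [e1 e2] := alt_exch N.
rewrite (dynkin2_alt ty) (dynkin2_alt (dynkin2_sym ty)) in e1 e2.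
have d1 := alt_exch_diag ff gg N (mem_alt N).
have d2 := alt_exch_diag ff gg N (mem_alt N.+1).
have {e1 e2 d1 d2} [[e1 e2] [d1 d2]] :
    (E N (alt_perm f g N f) (alt_perm f g N g) = k0 /\
     E N (alt_perm f g N g) (alt_perm f g N f) = - k1) /\
    (E N (alt_perm f g N f) (alt_perm f g N f) = 0 /\
     E N (alt_perm f g N g) (alt_perm f g N g) = 0).
  move: e1 e2 d1 d2; rewrite /v /alt /alt_perm /=.
  by case: (odd N) => /=; rewrite ?tpermL ?tpermR.
have [->|->|jfg] := alt_permP j.
- by move: ifg; rewrite !inE => /orP[] /eqP->; rewrite ?d1 ?e2 /k1 ?opprK.
- by move: ifg; rewrite !inE => /orP[] /eqP->; rewrite ?d2 ?e1.
rewrite (alt_perm_out jfg).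
have [/oppr_inj gN /oppr_inj gSN] := trop_period (dynkin2_sym ty) (col_rec jfg).
have [ef eg] : E N (alt_perm f g N f) j = dE D f j /\
    E N (alt_perm f g N g) j = dE D g j.
  apply: (alt_perm_alt (P := fun w x => E N w j = x)).
    exact: gSN.
  by rewrite col_prev gN /= opprK.
by move: ifg; rewrite !inE => /orP[] /eqP->.
Qed.

Variables (pos : F -> Prop) (posP : pos_cone pos).
Hypothesis pX : forall i, pos (dX D i).

Definition y_seq t := if t is t'.+1 then dX (alt_data D f g t') (v t') else (dX D g)^-1.

Lemma pos_alt_X t i : pos (dX (alt_data D f g t) i).
Proof. by elim: t i => // t IH i; apply: (pos_mutate_X posP). Qed.

Lemma pos_y_seq t : pos (y_seq t).
Proof. by case: t => [|t] /=; [apply: (posV posP)|apply: pos_alt_X]. Qed.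

Lemma y_prev t : dX (alt_data D f g t) (v t.+1) = (y_seq t)^-1.
Proof.
case: t => [|t]; first by rewrite /= invrK.
by rewrite [v t.+2]alt_succ2 /= -/(v t) eqxx.
Qed.

Lemma y_rec_alt : y_rec (alt k1 k0) y_seq.
Proof.
move=> t; have [_ e2] := alt_exch t.
rewrite {1}/y_seq /= -/(v t) -/(v t.+1) (negPf (alt_neq t)) -/(E t) y_prev e2 opprK.
rewrite -/(v t).
have -> : dX (alt_data D f g t) (v t) = y_seq t.+1 by [].
rewrite mulrAC mulVf ?(pos_neq0 posP (pos_y_seq t)) // mul1r.
have := alt_ge0 t.+1; rewrite alt_swap le_eqVlt => /orP[/eqP<-|k_gt0].
  by rewrite !expr0z.
by rewrite sgzN gtr0_sgz // opprK.
Qed.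

Lemma alt_cocycle n (z : nat -> F) : z 0%N != 0 ->
  (forall t, z t.+1 = z t * (1 + y_seq t.+1 ^ (- sgz (row_seq n t.+1)))
                              ^ (- row_seq n t.+1)) ->
  z N = z 0%N.
Proof. exact: (cocycle_period posP ty (row_rec n) pos_y_seq y_rec_alt). Qed.

Lemma alt_X_period i : dX (alt_data D f g N) (alt_perm f g N i) = dX D i.
Proof.
have [yN ySN] := y_period posP (dynkin2_sym ty) pos_y_seq y_rec_alt.
have [ef eg] : dX (alt_data D f g N) (alt_perm f g N f) = dX D f /\
    dX (alt_data D f g N) (alt_perm f g N g) = dX D g.
  apply: (alt_perm_alt (P := fun w x => dX (alt_data D f g N) w = x)).
    exact: ySN.
  by rewrite y_prev yN /= invrK.
have [->|->|ifg] := alt_permP i => //; rewrite alt_perm_out //.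
have iv s : i != v s by apply: contraNneq ifg => ->; apply: mem_alt.
apply: (alt_cocycle (n := dE D i) (z := fun t => dX (alt_data D f g t) i)).
  exact: (pos_neq0 posP (pX i)).
by move=> t; rewrite /= (negPf (iv t)) -/(v t) -/(E t) alt_exch_out.
Qed.

End Alternating.

Section AlternatingA.
Variables (I : finType) (F : fieldType) (pos : F -> Prop) (posP : pos_cone pos).
Variables (D : cdata I F) (f g : I) (N : nat).
Hypothesis fg : f != g.
Hypothesis fg_ge0 : 0 <= dE D f g.
Hypothesis gf_le0 : dE D g f <= 0.
Hypothesis ff : dE D f f = 0.
Hypothesis gg : dE D g g = 0.
Hypothesis pA : forall i, pos (dA D i).

Lemma alt_hat_E t : dE (alt_data (hat D) f g t) = dE (alt_data D f g t).
Proof. by elim: t => //= t ->. Qed.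

Lemma alt_hat_row n t : alt_row (hat D) f g n t = alt_row D f g n t.
Proof. by elim: t => //= t ->; rewrite alt_hat_E. Qed.

Lemma pos_alt_A t i : pos (dA (alt_data D f g t) i).
Proof. by elim: t i => // t IH i; apply: (pos_mutate_A posP). Qed.

Lemma alt_hatX t i : dX (alt_data (hat D) f g t) i =
  hatX (dE (alt_data D f g t)) (dA (alt_data D f g t)) i.
Proof.
elim: t i => // t IH i.
rewrite [RHS](hatX_mutate posP) //.
- by rewrite /= alt_hat_E !IH.
- exact: pos_alt_A.
- by apply: alt_exch_diag => //; apply: mem_alt.
Qed.

Lemma alt_monomial n t :
  \prod_j dA (alt_data D f g t.+1) j ^ alt_row D f g n t.+1 j =
  (\prod_j dA (alt_data D f g t) j ^ alt_row D f g n t j) *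
  (1 + hatX (dE (alt_data D f g t)) (dA (alt_data D f g t)) (alt f g t)
        ^ (- sgz (row_seq D f g n t.+1))) ^ (- row_seq D f g n t.+1).
Proof.
apply: (monomial_mutate posP); first exact: pos_alt_A.
by apply: alt_exch_diag => //; apply: mem_alt.
Qed.

(** The coordinate [A_i] is the monomial of a basis vector, hence evolves as an
    [X]-coordinate over [hat D] whose row is that vector. *)
Lemma alt_A_period i : dynkin2 (dE D f g) (- dE D g f) N ->
  dA (alt_data D f g N) (alt_perm f g N i) = dA D i.
Proof.
move=> ty; pose n j : int := (j == i)%:Z.
pose z t := \prod_j dA (alt_data D f g t) j ^ alt_row D f g n t j.
have single (A : I -> F) (m : I -> int) x : m x = 1 -> (forall j, j != x -> m j = 0) ->
    \prod_j A j ^ m j = A x.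
  move=> mx m0; rewrite (bigD1 x) //= mx expr1z big1 ?mulr1 // => j jx.
  by rewrite m0.
have z0 : z 0%N = dA D i.
  by apply: single => /= [|j ji]; rewrite /n ?eqxx // (negPf ji).
have -> : dA (alt_data D f g N) (alt_perm f g N i) = z N.
  rewrite /z (single _ _ (alt_perm f g N i)) //.
    by rewrite alt_row_period // /n eqxx.
  move=> j jx; have [h _ hK] := alt_perm_bij f g N.
  by rewrite -(hK j) alt_row_period // /n (_ : _ == _ = false) //;
    apply: contraNF jx => /eqP <-; rewrite hK.
rewrite -z0.
apply: (@alt_cocycle I F (hat D) f g fg fg_ge0 gf_le0 N ty pos posP _ n z) => //.
- by move=> j; apply: (pos_hatX posP).
- by rewrite z0; apply: (pos_neq0 posP).
- move=> t; rewrite /z alt_monomial /= alt_hat_row -/(alt_data _ _ _ t).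
  by rewrite -alt_hatX.
Qed.

End AlternatingA.

(** * Positive values and growth of rational functions *)

(** Evaluation of a rational function as a relation: a fraction has no preferred
    numerator and denominator, and any pair whose denominator survives at [v] will
    do. Positivity of the value is included as it is what inversion needs. *)
Definition pos_value (n : nat) (v : 'I_n -> rat) (x : {fraction {mpoly rat[n]}})
    (a : rat) :=
  0 < a /\ exists P Q : {mpoly rat[n]},
    [/\ Q.@[v] != 0, x * tofrac Q = tofrac P & a * Q.@[v] = P.@[v]].

Section PosValue.
Variables (n : nat) (v : 'I_n -> rat).
Implicit Types (x y : {fraction {mpoly rat[n]}}) (a b : rat).

Lemma tofrac_value_neq0 (Q : {mpoly rat[n]}) : Q.@[v] != 0 -> tofrac Q != 0.
Proof. by rewrite tofrac_eq0; apply: contraNneq => ->; rewrite meval0. Qed.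

Lemma pos_value_inj x a b : pos_value v x a -> pos_value v x b -> a = b.
Proof.
move=> [_ [P [Q [Q0 xQ aQ]]]] [_ [P' [Q' [Q0' xQ' bQ']]]].
have : P * Q' = P' * Q.
  by apply/eqP; rewrite -tofrac_eq !tofracM -xQ -xQ' mulrAC.
move=> /(congr1 (meval v)); rewrite !mevalM -aQ -bQ' => e.
by apply: (mulIf Q0); apply: (mulIf Q0'); rewrite e mulrAC.
Qed.

Lemma pos_value1 : pos_value v 1 1.
Proof. by split=> //; exists 1, 1; rewrite !meval1 oner_eq0 mulr1 tofrac1. Qed.

Lemma pos_valueD x y a b :
  pos_value v x a -> pos_value v y b -> pos_value v (x + y) (a + b).
Proof.
move=> [a0 [P [Q [Q0 xQ aQ]]]] [b0 [P' [Q' [Q0' yQ' bQ']]]].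
split; first exact: addr_gt0.
exists (P * Q' + P' * Q), (Q * Q'); rewrite mevalD !mevalM -aQ -bQ'; split.
- exact: mulf_neq0.
- by rewrite tofracD !tofracM -xQ -yQ'; ring.
- by ring.
Qed.

Lemma pos_valueM x y a b :
  pos_value v x a -> pos_value v y b -> pos_value v (x * y) (a * b).
Proof.
move=> [a0 [P [Q [Q0 xQ aQ]]]] [b0 [P' [Q' [Q0' yQ' bQ']]]].
split; first exact: mulr_gt0.
exists (P * P'), (Q * Q'); rewrite !mevalM -aQ -bQ'; split.
- exact: mulf_neq0.
- by rewrite !tofracM -xQ -yQ'; ring.
- by ring.
Qed.

Lemma pos_value_neq0 x a : pos_value v x a -> x != 0.
Proof.
move=> [a0 [P [Q [Q0 xQ aQ]]]].
have P0 : P.@[v] != 0 by rewrite -aQ mulf_neq0 // gt_eqF.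
by apply: contraNneq (tofrac_value_neq0 P0) => x0; rewrite -xQ x0 mul0r.
Qed.

Lemma pos_valueV x a : pos_value v x a -> pos_value v x^-1 a^-1.
Proof.
move=> xa; have x0 := pos_value_neq0 xa; case: xa => a0 [P [Q [Q0 xQ aQ]]].
have P0 : P.@[v] != 0 by rewrite -aQ mulf_neq0 // gt_eqF.
split; first by rewrite invr_gt0.
exists Q, P; split=> //.
- by rewrite -xQ mulKf.
- by rewrite -aQ mulKf // gt_eqF.
Qed.

Lemma pos_value_expz x a (m : int) : pos_value v x a -> pos_value v (x ^ m) (a ^ m).
Proof.
move=> xa; have pX k : pos_value v (x ^+ k) (a ^+ k).
  elim: k => [|k IH]; first by rewrite !expr0; apply: pos_value1.
  by rewrite !exprS; apply: pos_valueM.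
by case: m => m; [apply: pX|apply: pos_valueV; apply: pX].
Qed.

Lemma pos_value_prod (I : finType) (P : pred I) f (h : I -> rat) :
  (forall i, pos_value v (f i) (h i)) ->
  pos_value v (\prod_(i | P i) f i) (\prod_(i | P i) h i).
Proof.
move=> fh; apply: (big_ind2 (fun x a => pos_value v x a)) => //.
- exact: pos_value1.
- by move=> x1 x2 y1 y2; apply: pos_valueM.
Qed.

Definition pos_at x := exists a, pos_value v x a.

Lemma pos_at_cone : pos_cone pos_at.
Proof.
split.
- by exists 1; apply: pos_value1.
- by move=> x y [a xa] [b yb]; exists (a + b); apply: pos_valueD.
- by move=> x y [a xa] [b yb]; exists (a * b); apply: pos_valueM.
- by move=> x [a xa]; exists a^-1; apply: pos_valueV.
- by move=> x [a xa]; apply: pos_value_neq0 xa.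
Qed.

End PosValue.

Lemma pos_rat_cone : pos_cone (fun x : rat => 0 < x).
Proof.
split=> //; [exact: addr_gt0|exact: mulr_gt0| |by move=> x /gt_eqF ->].
by move=> x; rewrite invr_gt0.
Qed.

Definition trop_pt (s : seed) (l : tropical_point s) (M : nat) (i : 'I_#|s|) : rat :=
  M%:R ^ l (enum_val i).

(** [x] grows like [M ^ tau] along the curve with coordinates [M ^ l_i]: this reads
    off the tropicalization of a subtraction-free function from the function
    itself, whatever formula defines it. *)
Definition grows (s : seed) (l : tropical_point s) (x : ratfun s) (tau : int) :=
  exists2 C : rat, 0 < C & forall M : nat, (0 < M)%N ->
    exists2 a, pos_value (trop_pt l M) x a &
      C^-1 * M%:R ^ tau <= a /\ a <= C * M%:R ^ tau.

Section Growth.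
Variables (s : seed) (l : tropical_point s).
Implicit Types (x y : ratfun s) (tau : int).

Let natpow_gt0 (M : nat) tau : (0 < M)%N -> 0 < M%:R ^ tau :> rat.
Proof. by move=> M0; rewrite exprz_gt0 // ltr0n. Qed.

Lemma grows_var i : grows l (ratvar i) (l i).
Proof.
exists 1 => // M M0; exists (M%:R ^ l i); last by rewrite invr1 !mul1r.
split; first exact: natpow_gt0.
exists 'X_(enum_rank i), 1.
by rewrite meval1 oner_eq0 tofrac1 !mulr1 mevalXU /trop_pt enum_rankK.
Qed.

Lemma grows1 : grows l 1 0.
Proof.
by exists 1 => // M _; exists 1; [apply: pos_value1|rewrite expr0z invr1 mul1r].
Qed.

Lemma growsM x y tau tau' :
  grows l x tau -> grows l y tau' -> grows l (x * y) (tau + tau').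
Proof.
move=> [C C0 Cx] [C' C0' Cy]; exists (C * C') => [|M M0]; first exact: mulr_gt0.
have [a xa [a1 a2]] := Cx M M0; have [b yb [b1 b2]] := Cy M M0.
exists (a * b); first exact: pos_valueM.
have pt := natpow_gt0 tau M0; have pt' := natpow_gt0 tau' M0.
rewrite expfzDr ?pnatr_eq0 -?lt0n // invfM; split.
- by rewrite mulrACA ler_pM // ?mulr_ge0 ?invr_ge0 // ltW.
- by rewrite mulrACA ler_pM // ltW // ?xa.1 ?yb.1.
Qed.

Lemma growsV x tau : grows l x tau -> grows l x^-1 (- tau).
Proof.
move=> [C C0 Cx]; exists C => // M M0; have [a xa [a1 a2]] := Cx M M0.
have a0 := xa.1; have pt := natpow_gt0 tau M0.
exists a^-1; first exact: pos_valueV.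
rewrite -invr_expz -invfM -{2}[C]invrK -invfM.
by split; rewrite lef_pV2 // posrE ?mulr_gt0 // ?invr_gt0.
Qed.

Lemma grows_expz x tau (m : int) : grows l x tau -> grows l (x ^ m) (m * tau).
Proof.
move=> xt; have gX k : grows l (x ^+ k) (k%:Z * tau).
  elim: k => [|k IH]; first by rewrite expr0 mul0r; apply: grows1.
  rewrite exprS (_ : k.+1%:Z * tau = tau + k%:Z * tau); last by rewrite intS; ring.
  exact: growsM.
case: m => m; first exact: gX.
by rewrite NegzE mulNr -exprnN; apply: growsV; apply: gX.
Qed.

Lemma growsD x y tau tau' : grows l x tau -> grows l y tau' ->
  grows l (x + y) (Num.max tau tau').
Proof.
wlog tt' : x y tau tau' / tau' <= tau.
  move=> H xt yt; have /orP[h|h] := le_total tau' tau; first exact: H.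
  by rewrite addrC maxC; apply: H.
move=> [C C0 Cx] [C' C0' Cy]; rewrite max_l //.
exists (C + C') => [|M M0]; first exact: addr_gt0.
have [a xa [a1 a2]] := Cx M M0; have [b yb [b1 b2]] := Cy M M0.
exists (a + b); first exact: pos_valueD.
have pt := natpow_gt0 tau M0; have b0 := yb.1.
have le_pow : M%:R ^ tau' <= M%:R ^ tau :> rat.
  by rewrite ler_weXz2l // ler1n.
split.
- apply: le_trans (_ : C^-1 * M%:R ^ tau <= _); last first.
    by apply: le_trans a1 _; rewrite lerDl ltW.
  rewrite ler_pM2r // lef_pV2 ?posrE ?addr_gt0 //.
  by rewrite lerDl ltW.
- rewrite mulrDl lerD // (le_trans b2) // ler_pM2l //.
Qed.

(** Two different exponents would bound [M] by a constant. *)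
Lemma grows_inj x tau tau' : grows l x tau -> grows l x tau' -> tau = tau'.
Proof.
wlog tt' : tau tau' / tau < tau'.
  move=> H xt xt'; case: (ltgtP tau tau') => // h; first exact: H.
  by apply/esym; apply: H.
move=> [C C0 Cx] [C' C0' Cy].
have CC' : 0 <= C' * C by apply: mulr_ge0; apply: ltW.
pose M := (Num.bound (C' * C)).
have CM : C' * C < M%:R by apply: archi_boundP.
have M0 : (0 < M)%N by rewrite -(ltr0n rat) (le_lt_trans CC').
have [a xa [_ a2]] := Cx M M0; have [b xb [b1 _]] := Cy M M0.
have ab := pos_value_inj xa xb; subst b.
have pt := natpow_gt0 tau M0.
have : M%:R ^ tau' <= C' * C * M%:R ^ tau :> rat.
  by rewrite -mulrA -ler_pdivrMl //; apply: le_trans b1 _.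
rewrite -(subrK tau tau') expfzDr ?pnatr_eq0 -?lt0n // ler_pM2r // => le1.
have := le_lt_trans le1 CM; rewrite ltNge => /negP[].
by rewrite -{1}[M%:R]expr1z ler_weXz2l ?ler1n //; lia.
Qed.

End Growth.

(** * Cluster seeds as data *)

Lemma exch_skew_int (s : seed) (i j : s) :
  (mult i)%:Z * exch i j = - ((mult j)%:Z * exch j i).
Proof.
have d0 (k : s) : (mult k)%:R != 0 :> rat by rewrite pnatr_eq0 -lt0n mult_gt0.
apply/eqP; rewrite -(eqr_int rat) rmorphN !rmorphM /= -!pmulrn.
have e : (exch i j)%:Q = - ((exch j i)%:Q / (mult i)%:R) * (mult j)%:R.
  by rewrite -(exch_skew i j) divfK.
by rewrite e; apply/eqP; field; rewrite d0.
Qed.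

Lemma exch_diag (s : seed) (i : s) : exch i i = 0.
Proof.
have /eqP := exch_skew_int i i; rewrite -addr_eq0 -mulr2n -mulrnAr mulf_eq0.
rewrite mulrn_eq0 /= => /orP[|/eqP //].
by rewrite -[0]/(0%:Z) eqz_nat => /eqP d0; have := mult_gt0 i; rewrite d0.
Qed.

Definition mut (s : seed) (r : cluster_seed s) (k : r) : cluster_seed s :=
  ClusterSeed (ct_mutate k (ctrans r)).

Definition data_of (s : seed) (r : cluster_seed s) : cdata r (ratfun s) :=
  CData (@exch r) (X_coord (ctrans r)) (A_coord (ctrans r)).

(** Mutations and relabellings change the type of the vertices; seeds are compared
    by transporting their data to one fixed set of labels [I]. *)
Record represents (s : seed) (I : finType) (D : cdata I (ratfun s)) (m : I -> nat)
    (r : cluster_seed s) (phi : I -> r) : Prop := Represents {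
  rep_bij : bijective phi;
  rep_E : forall i j, exch (phi i) (phi j) = dE D i j;
  rep_m : forall i, mult (phi i) = m i;
  rep_X : forall i, X_coord (ctrans r) (phi i) = dX D i;
  rep_A : forall i, A_coord (ctrans r) (phi i) = dA D i
}.

Definition identified_via (s : seed) (p q : cluster_seed s) (phi : p -> q) :=
  represents (data_of p) (@mult p) phi.

Section Representation.
Variables (s : seed).
Implicit Types (p q r : cluster_seed s).

Lemma identifiedP p q : identified p q <-> exists phi : p -> q, identified_via phi.
Proof.
split=> [[f [fX fA]]|[phi [[psi phiK psiK] pE pm pX pA]]].
  exists f; split=> //; last exact: iso_mult.
    by exists (iso_inv f); [apply: iso_funK|apply: iso_invK].
  by move=> i j; apply: iso_exch.
by exists (SeedIso phiK psiK pE pm).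
Qed.

Lemma represents_mut (I : finType) (D : cdata I (ratfun s)) m r (phi : I -> r) k :
  represents D m phi ->
  @represents s I (mutate_data D k) m (mut (phi k)) phi.
Proof.
move=> [bij pE pm pX pA]; have eqk i : (phi i == phi k) = (i == k).
  by apply: inj_eq; apply: bij_inj.
split=> //.
- by move=> i j; rewrite /= /mutate_exch ![phi k == _]eq_sym !eqk !pE ![k == _]eq_sym.
- by move=> i; rewrite /= /mutate_X eqk pE !pX.
- move=> i; rewrite /= /mutate_A eqk !pA; case: ifP => // _.
  have bij' : {on [pred _ | true], bijective phi} by apply: onW_bij.
  congr ((_ + _) / _).
  + rewrite (reindex phi) /=; last exact: onW_bij.
    by apply: eq_big => [j|j _]; rewrite !pE ?pA.
  + rewrite (reindex phi) /=; last exact: onW_bij.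
    by apply: eq_big => [j|j _]; rewrite !pE ?pA.
Qed.

Lemma represents_perm (I : finType) (D D' : cdata I (ratfun s)) m r (phi : I -> r)
    (sigma : I -> I) : bijective sigma ->
  (forall i j, dE D' (sigma i) (sigma j) = dE D i j) ->
  (forall i, m (sigma i) = m i) ->
  (forall i, dX D' (sigma i) = dX D i) ->
  (forall i, dA D' (sigma i) = dA D i) ->
  represents D' m phi -> represents D m (phi \o sigma).
Proof.
move=> bs sE sm sX sA [bij pE pm pX pA]; split=> /=.
- exact: bij_comp.
- by move=> i j; rewrite pE.
- by move=> i; rewrite pm.
- by move=> i; rewrite pX.
- by move=> i; rewrite pA.
Qed.

Lemma represents_comp (I : finType) (D : cdata I (ratfun s)) m p q
    (phi : I -> p) (psi : p -> q) :
  represents D m phi -> identified_via psi -> represents D m (psi \o phi).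
Proof.
move=> [bij pE pm pX pA] [bij' pE' pm' pX' pA']; split=> /=.
- exact: bij_comp.
- by move=> i j; rewrite pE' /= pE.
- by move=> i; rewrite pm' /= pm.
- by move=> i; rewrite pX' /= pX.
- by move=> i; rewrite pA' /= pA.
Qed.

Lemma represents_identified (I : finType) (D : cdata I (ratfun s)) m p q
    (phi : I -> p) (psi : I -> q) : represents D m phi -> represents D m psi ->
  exists2 theta : p -> q, identified_via theta & forall i, theta (phi i) = psi i.
Proof.
move=> [[phi' phiK phiK'] pE pm pX pA] [bij' pE' pm' pX' pA'].
exists (psi \o phi') => [|i]; last by rewrite /= phiK.
split=> /= [|i j|i|i|i].
- by apply: bij_comp => //; exists phi.
- by rewrite pE' -pE !phiK'.
- by rewrite pm' -pm phiK'.
- by rewrite pX' -pX phiK'.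
- by rewrite pA' -pA phiK'.
Qed.

Lemma identified_via_id p : identified_via (@id p).
Proof. by split=> //; exists id. Qed.

Lemma identified_via_sym p q (phi : p -> q) : identified_via phi ->
  exists2 psi : q -> p, identified_via psi & cancel phi psi.
Proof.
move=> id_phi.
by have [psi] := represents_identified id_phi (identified_via_id p); exists psi.
Qed.

Lemma identified_refl p : identified p p.
Proof. by apply/identifiedP; exists id; apply: identified_via_id. Qed.

Lemma identified_sym p q : identified p q -> identified q p.
Proof.
move=> /identifiedP[phi /identified_via_sym[psi id_psi _]].
by apply/identifiedP; exists psi.
Qed.

Lemma identified_trans p q r : identified p q -> identified q r -> identified p r.
Proof.
move=> /identifiedP[phi id_phi] /identifiedP[psi id_psi].
by apply/identifiedP; exists (psi \o phi); apply: represents_comp.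
Qed.

Lemma identified_mut p q (phi : p -> q) k :
  identified_via phi -> identified (mut k) (mut (phi k)).
Proof.
move=> id_phi; apply/identifiedP; exists phi.
exact: (represents_mut k id_phi).
Qed.

Lemma identified_along p q (phi : p -> q) ks : identified_via phi ->
  identified (mutate_along (ctrans p) ks) (mutate_along (ctrans q) (map phi ks)).
Proof.
have [n] := ubnP (size ks); elim: n p q phi ks => // n IH p q phi [|k ks] /= kn id_phi.
  case: p q phi id_phi {kn} => [p cp] [q cq] phi id_phi.
  by apply/identifiedP; exists phi.
exact: (IH (mut k) (mut (phi k)) phi ks kn (represents_mut k id_phi)).
Qed.

Local Notation pos := (pos_at (fun _ : 'I_#|s| => 1)).

Let posP : pos_cone pos := pos_at_cone _.

Lemma pos_ratvar (i : s) : pos (ratvar i).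
Proof.
exists 1; split=> //; exists 'X_(enum_rank i), 1.
by rewrite meval1 oner_eq0 tofrac1 !mulr1 mevalXU.
Qed.

Lemma pos_X_coord t (c : cluster_transformation s t) i : pos (X_coord c i).
Proof.
elim: c i => [|u k c IH|u w f c IH] i /=; [exact: pos_ratvar| |exact: IH].
exact: (pos_mutate_X posP (D := CData (@exch u) (X_coord c) (A_coord c))).
Qed.

Lemma pos_A_coord t (c : cluster_transformation s t) i : pos (A_coord c i).
Proof.
elim: c i => [|u k c IH|u w f c IH] i /=; [exact: pos_ratvar| |exact: IH].
exact: (pos_mutate_A posP (D := CData (@exch u) (X_coord c) (A_coord c))).
Qed.

Lemma identified_via_mut_mut r (k : r) :
  @identified_via s r (mut (r := mut k) k) id.
Proof.
have pX i := pos_X_coord (ctrans r) i; have pA i := pos_A_coord (ctrans r) i.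
split=> //.
- by exists id.
- by move=> i j; apply: mutate_exchK.
- by move=> i; apply: (mutate_X_twice posP (D := data_of r)).
- by move=> i; apply: (mutate_A_twice posP (D := data_of r)) => //; apply: exch_diag.
Qed.

Lemma identified_mut_mut r (k : r) : identified r (mut (r := mut k) k).
Proof. by apply/identifiedP; exists id; apply: identified_via_mut_mut. Qed.

End Representation.

(** * The height of a seed *)

Fixpoint num_A (s t : seed) (c : cluster_transformation s t) : t -> rat :=
  match c with
  | ct_id => fun=> 1
  | ct_mutate _ k c => mutate_A k (num_A c)
  | ct_iso _ _ f c => fun i => num_A c (iso_inv f i)
  end.

Section Height.
Variable s : seed.
Implicit Types (p q r : cluster_seed s) (l : tropical_point s).

Lemma num_A_value t (c : cluster_transformation s t) i :
  pos_value (fun _ : 'I_#|s| => 1) (A_coord c i) (num_A c i).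
Proof.
elim: c i => [|u k c IH|u w f c IH] i /=; last exact: IH.
  split=> //; exists 'X_(enum_rank i), 1.
  by rewrite meval1 oner_eq0 tofrac1 !mulr1 mevalXU.
rewrite /mutate_A; case: ifP => _; last exact: IH.
apply: pos_valueM; last exact: pos_valueV.
by apply: pos_valueD; apply: pos_value_prod => j; apply: pos_value_expz.
Qed.

Lemma num_A_gt0 t (c : cluster_transformation s t) i : 0 < num_A c i.
Proof. by case: (num_A_value c i). Qed.

Lemma X_coord_grows l t (c : cluster_transformation s t) i :
  grows l (X_coord c i) (trop_coord c l i).
Proof.
elim: c i => [|u k c IH|u w f c IH] i /=; [exact: grows_var| |exact: IH].
rewrite /mutate_X /mutate_trop; case: ifP => _; first exact: growsV.
rewrite -mulNr; apply: growsM => //; apply: grows_expz.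
by apply: growsD; [apply: grows1|apply: grows_expz].
Qed.

(** The tropical coordinates are read off the [X]-coordinates, so that identified
    seeds have the same. *)
Lemma trop_identified l p q (phi : p -> q) i : identified_via phi ->
  trop_coord (ctrans q) l (phi i) = trop_coord (ctrans p) l i.
Proof.
move=> [_ _ _ pX _].
apply: (@grows_inj _ l (X_coord (ctrans p) i)); last exact: X_coord_grows.
by have := pX i; rewrite /= => <-; apply: X_coord_grows.
Qed.

Lemma num_A_identified p q (phi : p -> q) i : identified_via phi ->
  num_A (ctrans q) (phi i) = num_A (ctrans p) i.
Proof.
move=> [_ _ _ _ pA]; have := pA i; rewrite /= => e.
by apply: (pos_value_inj (num_A_value _ _)); rewrite e; apply: num_A_value.
Qed.

(** The multipliers turn skew-symmetrizability into antisymmetry, so that these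
    integers mutate as a row of the exchange matrix does. *)
Definition scaled_trop l r (i : r) : int := (mult i)%:Z * trop_coord (ctrans r) l i.

Lemma scaled_trop_identified l p q (phi : p -> q) i : identified_via phi ->
  scaled_trop l (phi i) = scaled_trop l i.
Proof.
by move=> id_phi; rewrite /scaled_trop (trop_identified _ _ id_phi) (rep_m id_phi).
Qed.

Lemma scaled_trop_mut l r (k i : r) :
  @scaled_trop l (mut k) i = mutate_row (@exch r k) k (@scaled_trop l r) i.
Proof.
rewrite {1}/scaled_trop /= /mutate_trop; have [->|ik] := eqVneq i k.
  by rewrite /mutate_row eqxx mulrN.
rewrite mutate_rowE // /scaled_trop.
move: (trop_coord _ _ i) (trop_coord _ _ k) => xi xk.
have e := exch_skew_int i k; have mi := mult_gt0 i; have mk := mult_gt0 k.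
have ppartM (m : nat) u : ppart (m%:Z * u) = m%:Z * ppart u by rewrite /ppart; nia.
rewrite ppartM mulrBr mulrA e mulNr opprK; congr (_ + _).
have [eik|eik|eik] := ltrgt0P (exch i k).
- have eki : exch k i < 0 by nia.
  rewrite gtr0_sgz // (ppart_id (u := - exch k i)) ?mulN1r; last by rewrite oppr_ge0 ltW.
  have -> : Num.max 0 (- xk) = ppart xk - xk by rewrite /ppart; lia.
  by ring.
- have eki : 0 < exch k i by nia.
  rewrite ltr0_sgz // (ppart_eq0 (u := - exch k i)) ?mulr0 ?addr0; last first.
    by rewrite oppr_le0 ltW.
  by rewrite opprK mul1r /ppart maxC; ring.
- have -> : exch k i = 0 by nia.
  by rewrite oppr0 (ppart_id (u := 0)) // !mulr0 mul0r addr0.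
Qed.

(** The pairing of the tropical point with the positive point at which all
    [A]-coordinates of the base seed are [1], written multiplicatively. *)
Definition height l r : rat := \prod_(i : r) num_A (ctrans r) i ^ scaled_trop l i.

Lemma height_identified l p q : identified p q -> height l p = height l q.
Proof.
move=> /identifiedP[phi id_phi]; rewrite /height [RHS](reindex phi) /=; last first.
  exact/onW_bij/(rep_bij id_phi).
apply: eq_bigr => i _.
by rewrite (num_A_identified _ id_phi) (scaled_trop_identified _ _ id_phi).
Qed.

Lemma height_gt0 l r : 0 < height l r.
Proof. by apply: prodr_gt0 => i _; rewrite exprz_gt0 // num_A_gt0. Qed.

(** The height is the monomial with exponent row [scaled_trop l]. *)
Lemma height_mut l r (k : r) (n := scaled_trop l k) : exists2 X : rat, 0 < X &
  height l (mut k) = height l r * (1 + X) ^ (- n).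
Proof.
pose D := CData (@exch r) (num_A (ctrans r)) (num_A (ctrans r)).
exists (hatX (dE D) (dA D) k ^ (- sgz n)).
  apply/exprz_gt0/(pos_hatX pos_rat_cone) => j; exact: num_A_gt0.
rewrite -[RHS](monomial_mutate pos_rat_cone (D := D)) //.
- by apply: eq_bigr => i _; rewrite scaled_trop_mut.
- by move=> i; apply: num_A_gt0.
- exact: exch_diag.
Qed.

Lemma height_up l r (k : r) : scaled_trop l k < 0 -> height l r < height l (mut k).
Proof.
have [X X0 ->] := height_mut l k; move=> n0.
rewrite ltr_pMr ?height_gt0 // -[ltLHS](expr0z (1 + X)).
by rewrite ltr_eXz2l ?oppr_gt0 // ltrDl.
Qed.

Lemma height_down l r (k : r) : 0 < scaled_trop l k -> height l (mut k) < height l r.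
Proof.
have [X X0 ->] := height_mut l k; move=> n0.
rewrite gtr_pMr ?height_gt0 // -[ltRHS](expr0z (1 + X)).
by rewrite ltr_eXz2l ?oppr_lt0 // ltrDl.
Qed.

Lemma height_level l r (k : r) : scaled_trop l k = 0 -> height l (mut k) = height l r.
Proof. by have [X X0 ->] := height_mut l k => ->; rewrite oppr0 expr0z mulr1. Qed.

Lemma trop_coord_surj t (c : cluster_transformation s t) (x : t -> int) :
  exists l, forall i, trop_coord c l i = x i.
Proof.
elim: c x => [|u k c IH|u w f c IH] x /=; first by exists x.
  have [l lx] := IH (@mutate_trop (mutate k) k x); exists l => i.
  have -> : x i = mutate_trop k (@mutate_trop (mutate k) k x) i.
    rewrite /mutate_trop /= eqxx; case: (eqVneq i k) => [->|ik]; first by rewrite opprK.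
    by rewrite /mutate_exch eqxx orbT sgzN opprK mulrNN mulNr opprK addrK.
  by rewrite /mutate_trop !lx.
have [l lx] := IH (fun i => x (f i)); exists l => i.
by rewrite lx iso_invK.
Qed.

(** * Alternating paths of seeds *)

(** The seeds of an alternating path carry along their vertices as relabelled vertices
    of [r], since their types coincide with that of [r] only up to computation for
    each given [t]. *)
Fixpoint alt_path r (f g : r) t : {q : cluster_seed s & r -> q} :=
  if t is t'.+1 then
    let w := alt_path f g t' in
    existT (fun q : cluster_seed s => r -> q)
      (mut (projT2 w (alt f g t'))) (projT2 w)
  else existT (fun q : cluster_seed s => r -> q) r id.

Definition alt_seed r (f g : r) t : cluster_seed s := projT1 (alt_path f g t).
Definition alt_vertex r (f g : r) t : r -> alt_seed f g t := projT2 (alt_path f g t).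

Lemma alt_seed_mut r (f g : r) t :
  alt_seed f g t.+1 = mut (alt_vertex f g t (alt f g t)).
Proof. by []. Qed.

Lemma alt_represents r (f g : r) t :
  represents (alt_data (data_of r) f g t) (@mult r) (alt_vertex f g t).
Proof.
elim: t => [|t IH]; first exact: identified_via_id.
exact: (represents_mut _ IH).
Qed.

Lemma alt_scaled_trop l r (f g : r) t i :
  scaled_trop l (alt_vertex f g t i) = alt_row (data_of r) f g (@scaled_trop l r) t i.
Proof.
elim: t i => // t IH i; have rep := alt_represents f g t.
set k := alt f g t.
rewrite [LHS](scaled_trop_mut l (alt_vertex f g t k) (alt_vertex f g t i)).
rewrite /mutate_row /= -/k (inj_eq (bij_inj (rep_bij rep))).
by rewrite !(rep_E rep) !IH.
Qed.

Lemma alt_scaled_trop_next l r (f g : r) t :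
  scaled_trop l (alt_vertex f g t (alt f g t)) =
  row_seq (data_of r) f g (@scaled_trop l r) t.+1.
Proof. exact: alt_scaled_trop. Qed.

Lemma alt_seed_period r (f g : r) N : f != g -> dynkin2 (exch f g) (- exch g f) N ->
  identified_via (alt_vertex f g N \o alt_perm f g N).
Proof.
move=> fg ty.
have fg0 : 0 <= exch f g by case: ty.
have gf0 : exch g f <= 0 by rewrite -oppr_ge0; case: ty.
have cone := pos_at_cone (fun _ : 'I_#|s| => 1).
apply: (represents_perm (alt_perm_bij f g N)) (alt_represents f g N).
- by move=> i j; apply: alt_exch_period => //; apply: exch_diag.
- rewrite /alt_perm => i; case: ifP => // oN.
  have mfg : mult f = mult g.
    have [e1 e2] := dynkin2_odd ty oN.
    have := exch_skew_int f g; rewrite e1 -mulrN e2 !mulr1 => /eqP.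
    by rewrite eqz_nat => /eqP.
  by case: tpermP => [->|->|].
- move=> i; apply: (alt_X_period (D := data_of r) fg fg0 gf0 ty cone) => j.
  exact: pos_X_coord.
- move=> i; apply: (alt_A_period (D := data_of r) cone fg fg0 gf0) => //.
  + exact: exch_diag.
  + exact: exch_diag.
  + by move=> j; apply: pos_A_coord.
Qed.

End Height.

(** * Heights along a polygon *)

Lemma dynkin2_exists (k0 k1 : int) : 0 <= k0 -> 0 <= k1 ->
  (k0 == 0) = (k1 == 0) -> k0 * k1 < 4 -> exists N, dynkin2 k0 k1 N.
Proof.
case: k0 => // -[|[|[|[|k0]]]] _; case: k1 => // -[|[|[|[|k1]]]] _ //= _ lt4; try lia.
- by exists 4%N; constructor.
- by exists 5%N; constructor.
- by exists 6%N; constructor.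
- by exists 8%N; constructor.
- by exists 6%N; constructor.
- by exists 8%N; constructor.
Qed.

(** The bound [2 * u t <= k t * u t.+1] propagates because [k0 * k1 >= 4]. *)
Lemma trop_rec_unbounded k0 k1 u : 0 <= k0 -> 0 <= k1 -> 4 <= k0 * k1 ->
  trop_rec (alt k0 k1) u -> u 0%N = 0 -> 0 < u 1%N -> forall t, 0 < u t.+1.
Proof.
move=> k00 k10 k4 urec u0 u1 t.
suff : [/\ 0 <= u t, 0 < u t.+1 & 2 * u t <= alt k0 k1 t * u t.+1] by case.
elim: t => [|t [IH0 IH1 IH2]].
  by rewrite u0; split=> //; rewrite mulr0 mulr_ge0 // ltW.
have kt : 4 <= alt k0 k1 t * alt k0 k1 t.+1.
  by rewrite /alt /=; case: (odd t) => //=; rewrite mulrC.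
have kt0 : 0 <= alt k0 k1 t by rewrite /alt; case: ifP.
have kt1 : 0 <= alt k0 k1 t.+1 by rewrite /alt; case: ifP.
have := urec t; rewrite (ppart_id (ltW IH1)); move: kt kt0 kt1 IH0 IH1 IH2.
move: (alt _ _ t) (alt _ _ t.+1) (u t) (u t.+1) (u t.+2).
move=> a b x y z ab a0 b0 x0 y0 xy zE.
have {zE} zE : z = a * y - x by lia.
have a1 : 0 < a by nia.
split; first exact: ltW.
- have [xE|xn0] := eqVneq x 0; last by lia.
  by rewrite zE xE; nia.
- have h1 : 4 * y <= a * b * y by rewrite ler_pM2r.
  have h2 : b * (2 * x) <= b * (a * y) by rewrite ler_wpM2l.
  by rewrite zE; nia.
Qed.

Lemma trop_rec_signs k0 k1 N u : dynkin2 k0 k1 N -> trop_rec (alt k0 k1) u ->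
  0 <= u 0%N -> u 1%N <= 0 -> (0 < u 0%N) || (u 1%N < 0) ->
  [/\ u 2%N = - u 0%N, forall t, (3 <= t <= N)%N -> 0 <= u t
    & forall t, (4 <= t < N)%N -> 0 < u t].
Proof.
move=> ty urec u0 u1 u01.
have := (urec 0, urec 1, urec 2, urec 3, urec 4, urec 5, urec 6)%N.
rewrite /ppart; case: ty urec => _; rewrite /alt /= => - [[[[[[h0 h1] h2] h3] h4] h5] h6].
all: have u2 : u 2%N = - u 0%N by lia.
all: have u3 : u 3%N = - u 1%N by lia.
all: split=> // t tN.
all: have : t \in [:: 3; 4; 5; 6; 7; 8]%N by rewrite !inE; lia.
all: rewrite !inE.
all: move=> /orP[/eqP ?|/or4P[/eqP ?|/eqP ?|/eqP ?|/orP[/eqP ?|/eqP ?]]]; subst t.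
all: lia.
Qed.

(** The terms [u 1] and [u 2] are non-positive and all later ones non-negative, so the
    height rises for two steps and falls back afterwards. *)
Lemma polygon_heights k0 k1 N u (H : nat -> rat) :
  dynkin2 k0 k1 N -> trop_rec (alt k0 k1) u ->
  0 <= u 0%N -> u 1%N <= 0 -> (0 < u 0%N) || (u 1%N < 0) ->
  (forall t, u t.+1 < 0 -> H t < H t.+1) ->
  (forall t, 0 < u t.+1 -> H t.+1 < H t) ->
  (forall t, u t.+1 = 0 -> H t.+1 = H t) ->
  H N = H 0%N ->
  [/\ u 1%N < 0 -> H 0%N < H 1%N, 0 < u 0%N -> H 0%N < H N.-1
    & forall t, (2 <= t <= N - 2)%N -> H 0%N < H t].
Proof.
move=> ty urec u0 u1 u01 up down level HN.
have [u2 upos ugt0] := trop_rec_signs ty urec u0 u1 u01.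
have [uN _] := trop_period ty urec.
have N4 : (4 <= N)%N by case: ty.
have low t : (2 <= t <= N)%N -> H 0%N <= H t.
  move=> tN; rewrite -HN; have [m] := ubnP (N - t)%N.
  elim: m t tN => // m IH t tN tm; have [->//|tN'] := eqVneq t N.
  apply: le_trans (IH t.+1 _ _) _; [lia|lia|].
  have : 0 <= u t.+1 by apply: upos; lia.
  by rewrite le_eqVlt => /orP[/eqP/esym/level->//|/down/ltW].
split=> [|u0p|t tN]; first exact: up.
  have NE : N = N.-1.+1 by lia.
  by rewrite -HN {1}NE; apply: down; rewrite -NE uN.
have [->|t2] := eqVneq t 2%N.
  have up1 v : u v.+1 <= 0 -> H v <= H v.+1.
    by rewrite le_eqVlt => /orP[/eqP/level->//|/up/ltW].
  have [u0p|u0n] := boolP (0 < u 0%N).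
    by apply: le_lt_trans (up1 0%N u1) _; apply: up; rewrite u2 oppr_lt0.
  apply: lt_le_trans (up 0%N _) (up1 1%N _); first by move: u01; rewrite (negPf u0n).
  by rewrite u2 oppr_le0.
apply: le_lt_trans (low t.+1 _) (down _ _); first lia.
by apply: ugt0; lia.
Qed.

(** * Local confluence *)

Section FiniteType.
Variables (s : seed) (n : nat) (q : 'I_n -> cluster_seed s).
Hypothesis q_all : forall p, exists m, identified (q m) p.
Implicit Types (r p : cluster_seed s) (l : tropical_point s).

(** As heights form a finite set, counting the smaller ones turns them into natural
    numbers. *)
Definition rank l r := #|[pred m | height l (q m) < height l r]|.

Lemma rank_bound l r : (rank l r <= n)%N.
Proof. by rewrite -[leqRHS]card_ord max_card. Qed.

Lemma rank_lt l r p : height l r < height l p -> (rank l r < rank l p)%N.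
Proof.
move=> rp; apply: proper_card; apply/properP; split.
  by apply/subsetP => m; rewrite !inE => /lt_trans; apply.
have [m /height_identified qm] := q_all r.
by exists m; rewrite !inE qm ?ltxx.
Qed.

Lemma rank_eq l r p : height l r = height l p -> rank l r = rank l p.
Proof. by move=> e; rewrite /rank e. Qed.

Lemma exch_sign_sym (r : seed) (a b : r) : 0 <= exch a b ->
  exch b a <= 0 /\ (exch a b == 0) = (- exch b a == 0).
Proof.
move=> ab; have e := exch_skew_int a b.
have ma := mult_gt0 a; have mb := mult_gt0 b.
have ba : exch b a <= 0 by nia.
split=> //; apply/eqP/eqP; nia.
Qed.

(** Otherwise mutating [a] and [b] in turn would lower the height of some tropical
    point forever. *)
Lemma exch_dynkin2 r (a b : r) : a != b -> 0 <= exch a b ->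
  exists N, dynkin2 (exch a b) (- exch b a) N.
Proof.
move=> ab eab; have [eba e0] := exch_sign_sym eab.
have eba' : 0 <= - exch b a by rewrite oppr_ge0.
apply: dynkin2_exists => //; rewrite ltNge; apply/negP => k4.
(* The point supported at [a] has [u 0 = 0] and [u 1 > 0]. *)
have [l lx] := trop_coord_surj (ctrans r) (fun i => (i == a)%:Z).
pose u := row_seq (data_of r) a b (@scaled_trop _ l r).
have u_gt0 t : 0 < u t.+1.
  apply: (trop_rec_unbounded eab eba' k4) => //.
  - exact: (row_rec (D := data_of r) ab eab eba).
  - by rewrite /u /= /scaled_trop lx eq_sym (negPf ab) mulr0 oppr0.
  - by rewrite /u /= /scaled_trop lx eqxx mulr1 ltz_nat mult_gt0.
have fall t : (rank l (alt_seed a b t) + t <= rank l r)%N.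
  elim: t => [|t IH]; first by rewrite addn0.
  apply: leq_trans IH; rewrite addnS ltn_add2r; apply: rank_lt.
  by apply: height_down; rewrite alt_scaled_trop_next.
by have := fall (rank l r).+1; lia.
Qed.

Variable l : tropical_point s.

Definition up r p := exists2 k : r, scaled_trop l k < 0 & p = mut k.
Definition level r p :=
  identified r p \/ exists2 k : r, scaled_trop l k = 0 & identified (mut k) p.

Lemma up_rank r p : up r p -> (rank l r < rank l p)%N.
Proof. by case=> k k0 ->; apply/rank_lt/height_up. Qed.

Lemma identified_rank r p : identified r p -> rank l r = rank l p.
Proof. by move=> rp; apply/rank_eq/height_identified. Qed.

Lemma level_rank r p : level r p -> rank l r = rank l p.
Proof.
case=> [|[k k0 kp]]; first exact: identified_rank.
by rewrite -(identified_rank kp); apply/rank_eq; rewrite height_level.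
Qed.

Lemma scaled_trop_mut_self r (k : r) :
  @scaled_trop _ l (mut k) k = - scaled_trop l k.
Proof. by rewrite scaled_trop_mut /mutate_row eqxx. Qed.

Lemma level_sym r p : level r p -> level p r.
Proof.
case=> [/identified_sym|[k k0 /identifiedP[phi id_phi]]]; first by left.
right; exists (phi k).
  by rewrite (scaled_trop_identified _ _ id_phi) scaled_trop_mut_self k0 oppr0.
apply: identified_trans (identified_sym (identified_mut_mut k)).
exact/identified_sym/(identified_mut (p := mut k) k id_phi).
Qed.

Local Notation conn := (conn up level).

Section Closed.
Variable P : cluster_seed s -> Prop.
Hypothesis P_identified : forall r p, identified r p -> P r -> P p.

Lemma conn_identified r p : P r -> identified r p -> conn P r p.
Proof. by move=> Pr rp; apply: conn_level => //; [apply: P_identified Pr|left]. Qed.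

Lemma conn_mut r (k : r) : P r -> P (mut k) -> conn P r (mut k).
Proof.
move=> Pr Pk; have [k0|k0|k0] := ltrgt0P (scaled_trop l k).
- have kk := identified_mut_mut k; have Pkk := P_identified kk Pr.
  apply: conn_trans (conn_identified Pr kk) (conn_sym _).
  by apply: conn_up => //; exists k => //; rewrite scaled_trop_mut_self oppr_lt0.
- by apply: conn_up => //; exists k.
- by apply: conn_level => //; right; exists k => //; apply: identified_refl.
Qed.

Lemma conn_alt r (f g : r) i j : (i <= j)%N ->
  (forall t, (i <= t <= j)%N -> P (alt_seed f g t)) ->
  conn P (alt_seed f g i) (alt_seed f g j).
Proof.
elim: j => [|j IH].
  by rewrite leqn0 => /eqP-> PP; apply/conn_refl/PP.
rewrite leq_eqVlt ltnS => /orP[/eqP->|ij] PP; first by apply/conn_refl/PP; rewrite leqnn.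
have PP' t : (i <= t <= j)%N -> P (alt_seed f g t).
  by move=> /andP[it tj]; apply: PP; rewrite it leqW.
apply: conn_trans (IH ij PP') _.
by apply: conn_mut; [|rewrite -alt_seed_mut]; apply: PP; lia.
Qed.

End Closed.

Lemma above_identified m r p : identified r p -> above (rank l) m r -> above (rank l) m p.
Proof. by rewrite /above => /identified_rank ->. Qed.

Section Polygon.
Variables (r : cluster_seed s) (f g : r).
Hypothesis fg : f != g.
Hypothesis efg : 0 <= exch f g.
Hypothesis f_le0 : scaled_trop l f <= 0.
Hypothesis g_le0 : scaled_trop l g <= 0.

(** Undoing the last mutation of the closed polygon starts from the image of [r], at the
    vertex where [g] has been relabelled to. *)
Lemma polygon_last N : dynkin2 (exch f g) (- exch g f) N ->
  exists2 theta : alt_seed f g N.-1 -> mut g, identified_via theta &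
    theta (alt_vertex f g N.-1 (alt f g N)) = f.
Proof.
move=> ty; have N4 : (4 <= N)%N by case: ty.
have [m NE] : exists m, N = m.+1 by exists N.-1; lia.
subst N; rewrite [m.+1.-1]/=.
have id1 := alt_seed_period fg ty.
have id2 := represents_mut g id1.
have altE : alt_perm f g m.+1 g = alt f g m /\ alt_perm f g m.+1 f = alt f g m.+1.
  by rewrite /alt_perm /alt /=; case: (odd m) => /=; rewrite ?tpermL ?tpermR.
set phi := alt_vertex f g m.
have id3 : identified_via (p := mut g)
    (q := mut (r := mut (phi (alt f g m))) (phi (alt f g m))) (phi \o alt_perm f g m.+1).
  by have := id2; rewrite /= altE.1.
have [theta id_theta thetaK] := identified_via_sym id3.
exists theta; last by rewrite -altE.2; apply: thetaK.
exact: (represents_comp (identified_via_mut_mut (phi (alt f g m))) id_theta).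
Qed.

Lemma polygon_above : (scaled_trop l f < 0) || (scaled_trop l g < 0) ->
  exists2 N, dynkin2 (exch f g) (- exch g f) N &
  [/\ scaled_trop l f < 0 -> height l r < height l (alt_seed f g 1),
      scaled_trop l g < 0 -> height l r < height l (alt_seed f g N.-1)
    & forall t, (2 <= t <= N - 2)%N -> height l r < height l (alt_seed f g t)].
Proof.
move=> fg_lt0; have [N ty] := exch_dynkin2 fg efg; exists N => //.
have [gf0 _] := exch_sign_sym efg.
pose u := row_seq (data_of r) f g (@scaled_trop _ l r).
have urec : trop_rec (alt (exch f g) (- exch g f)) u.
  exact: (row_rec (D := data_of r) fg efg gf0).
have [] := polygon_heights (H := fun t => height l (alt_seed f g t)) ty urec.
- by rewrite /u /= oppr_ge0.
- exact: f_le0.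
- by rewrite /u /= oppr_gt0 orbC.
- by move=> t ut; apply: height_up; rewrite alt_scaled_trop_next.
- by move=> t ut; apply: height_down; rewrite alt_scaled_trop_next.
- by move=> t ut; apply: height_level; rewrite alt_scaled_trop_next.
- have /(fun h => ex_intro _ _ h) /identifiedP := alt_seed_period fg ty.
  by move=> /(height_identified l) ->.
- by rewrite /u /= oppr_gt0 => h1 h2 h3; split.
Qed.

(** From [mut f] to [mut g] the long way around. *)
Lemma polygon_peak : scaled_trop l f < 0 -> scaled_trop l g < 0 ->
  conn (above (rank l) (rank l r)) (mut f) (mut g).
Proof.
move=> f0 g0; have [|N ty [/(_ f0) h1 /(_ g0) hN ht]] := polygon_above.
  by rewrite f0.
have N4 : (4 <= N)%N by case: ty.
have [theta id_theta _] := polygon_last ty.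
have last_id : identified (alt_seed f g N.-1) (mut g).
  by apply/identifiedP; exists theta.
have ab t : (1 <= t <= N.-1)%N -> above (rank l) (rank l r) (alt_seed f g t).
  move=> tN; apply: rank_lt; have [->//|t1] := eqVneq t 1%N.
  by have [->//|t2] := eqVneq t N.-1; apply: ht; lia.
have closed := @above_identified (rank l r).
apply: conn_trans (conn_alt closed (j := N.-1) _ ab) _; first lia.
by apply: conn_identified last_id => //; apply: ab; lia.
Qed.

(** The level edge from [r] to [mut g] is the last edge of the polygon, and the
    mutation at [f] then leads to the last vertex before it. *)
Lemma polygon_cross_f : scaled_trop l f < 0 -> scaled_trop l g = 0 ->
  conn (above (rank l) (rank l r)) (mut f) (mut (r := mut g) f).
Proof.
move=> f0 g0; have [|N ty [/(_ f0) h1 _ ht]] := polygon_above.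
  by rewrite f0.
have N4 : (4 <= N)%N by case: ty.
have [theta id_theta thetaE] := polygon_last ty.
have last_id : identified (alt_seed f g (N - 2)) (mut (r := mut g) f).
  suff: identified (alt_seed f g (N - 2)) (mut (theta (alt_vertex f g N.-1 (alt f g N)))).
    by rewrite thetaE.
  have [m NE] : exists m, N = m.+2 by exists (N - 2)%N; lia.
  move: theta id_theta {thetaE}; rewrite NE (_ : m.+2 - 2 = m)%N; last by lia.
  rewrite alt_succ2 => theta id_theta.
  pose k := alt_vertex f g m.+1 (alt f g m).
  apply: (identified_trans (q := mut k)).
    exact: (identified_mut_mut (alt_vertex f g m (alt f g m))).
  exact: (identified_mut k id_theta).
have ab t : (1 <= t <= N - 2)%N -> above (rank l) (rank l r) (alt_seed f g t).
  move=> tN; apply: rank_lt; have [->//|t1] := eqVneq t 1%N.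
  by apply: ht; lia.
have closed := @above_identified (rank l r).
apply: conn_trans (conn_alt closed (j := (N - 2)%N) _ ab) _; first lia.
by apply: conn_identified last_id => //; apply: ab; lia.
Qed.

(** Here the level edge is the first edge of the polygon. *)
Lemma polygon_cross_g : scaled_trop l f = 0 -> scaled_trop l g < 0 ->
  conn (above (rank l) (rank l r)) (mut g) (mut (r := mut f) g).
Proof.
move=> f0 g0; have [|N ty [_ /(_ g0) hN ht]] := polygon_above.
  by rewrite g0 orbT.
have N4 : (4 <= N)%N by case: ty.
have [theta id_theta _] := polygon_last ty.
have last_id : identified (alt_seed f g N.-1) (mut g).
  by apply/identifiedP; exists theta.
have ab t : (2 <= t <= N.-1)%N -> above (rank l) (rank l r) (alt_seed f g t).
  move=> tN; apply: rank_lt; have [->//|t2] := eqVneq t N.-1.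
  by apply: ht; lia.
have closed := @above_identified (rank l r).
apply: conn_sym; apply: conn_trans (conn_alt closed (i := 2) (j := N.-1) _ ab) _.
  by lia.
by apply: conn_identified last_id => //; apply: ab; lia.
Qed.

End Polygon.

Lemma exch_orient (r : seed) (a b : r) : 0 <= exch a b \/ 0 <= exch b a.
Proof.
have e := exch_skew_int a b; have ma := mult_gt0 a; have mb := mult_gt0 b.
by have [|] := leP 0 (exch a b); [left|right; nia].
Qed.

Lemma up_peak r a b : up r a -> up r b -> conn (above (rank l) (rank l r)) a b.
Proof.
move=> [k k0 ->] [k' k'0 ->]; have [->|kk'] := eqVneq k k'.
  by apply/conn_refl/up_rank; exists k'.
have [ekk|ekk] := exch_orient k k'.
  by apply: polygon_peak => //; apply: ltW.
by apply: conn_sym; apply: polygon_peak; rewrite 1?eq_sym // ltW.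
Qed.

Lemma scaled_trop_mut_level r (k i : r) : scaled_trop l k = 0 ->
  @scaled_trop _ l (mut k) i = scaled_trop l i.
Proof.
move=> k0; rewrite scaled_trop_mut; have [->|ik] := eqVneq i k.
  by rewrite /mutate_row eqxx k0 oppr0.
by rewrite mutate_rowE // k0 /ppart maxxx !mul0r !addr0.
Qed.

Lemma up_cross_mut r (a b : r) : scaled_trop l a < 0 -> scaled_trop l b = 0 ->
  up (mut b) (mut (r := mut b) a) /\
  conn (above (rank l) (rank l r)) (mut a) (mut (r := mut b) a).
Proof.
move=> a0 b0; split; first by exists a => //; rewrite scaled_trop_mut_level.
have ab : a != b by apply: contraTneq a0 => ->; rewrite b0 ltxx.
have [eab|eba] := exch_orient a b.
  by apply: polygon_cross_f; rewrite // ?b0 // ltW.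
by apply: polygon_cross_g; rewrite // 1?eq_sym ?b0 // ltW.
Qed.

Lemma up_cross_identified r b (k : r) : scaled_trop l k < 0 -> identified r b ->
  exists2 c, up b c & identified (mut k) c.
Proof.
move=> k0 /identifiedP[phi id_phi]; exists (mut (phi k)).
  by exists (phi k) => //; rewrite (scaled_trop_identified _ _ id_phi).
exact: identified_mut.
Qed.

Lemma up_cross r a b : up r a -> level r b ->
  exists2 c, up b c & conn (above (rank l) (rank l r)) a c.
Proof.
have closed := @above_identified (rank l r).
move=> [k k0 ->] [rb|[j j0 jb]].
  have [c bc kc] := up_cross_identified k0 rb; exists c => //.
  by apply: conn_identified kc => //; apply: up_rank; exists k.
have [jk conn_jk] := up_cross_mut k0 j0.
have k0' : @scaled_trop _ l (mut j) k < 0 by rewrite scaled_trop_mut_level.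
have [c bc kc] := up_cross_identified (r := mut j) k0' jb; exists c => //.
apply: conn_trans conn_jk (conn_identified closed _ kc).
by apply: leq_ltn_trans (up_rank jk); rewrite -(level_rank (r := r)) //;
  right; exists j => //; apply: identified_refl.
Qed.

(** * Non-negative seeds *)

Lemma conn_base p : conn (fun=> True) (ClusterSeed (ct_id s)) p.
Proof.
case: p => t c; elim: c => [|u k c IH|u w f c IH]; first exact: conn_refl.
  exact: conn_trans IH (conn_mut (r := ClusterSeed c) _ _ _).
apply: conn_trans IH _; apply: conn_level => //; left.
by exists f; split=> i /=; rewrite iso_funK.
Qed.

Lemma scaled_trop_ge0 p (i : p) : non_negative l p -> 0 <= scaled_trop l i.
Proof. by move=> /(_ i) i0; apply: mulr_ge0. Qed.

Lemma trop_coord_mut_level r (k i : r) : scaled_trop l k = 0 ->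
  @trop_coord s (mut k) (ctrans (mut k)) l i = trop_coord (ctrans r) l i.
Proof.
move=> k0; have := scaled_trop_mut_level i k0; rewrite /scaled_trop /=.
by apply: mulfI; rewrite -[0]/(0%:Z) eqz_nat -lt0n mult_gt0.
Qed.

Lemma level_non_negative r p : level r p -> non_negative l r -> non_negative l p.
Proof.
have idn r' p' : identified r' p' -> non_negative l r' -> non_negative l p'.
  move=> /identified_sym/identifiedP[phi id_phi] r0 i.
  by rewrite -(trop_identified l i id_phi).
case=> [|[k k0 /idn kp] r0]; first exact: idn.
by apply: kp => i; rewrite trop_coord_mut_level.
Qed.

Lemma non_negative_maximal p : non_negative l p -> maximal up level p.
Proof.
move=> p0 p' b pp' [k k0 _]; suff p'0 : non_negative l p'.
  by have := scaled_trop_ge0 k p'0; rewrite leNgt k0.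
by elim: pp' p0 {k k0} => // x y z /level_non_negative xy _ IH /xy.
Qed.

(** Vanishing coordinates are not affected by mutations at vanishing coordinates, so
    the zero subseed is the same all along a path of level edges. *)
Lemma level_subseed_equivalent p p' : clos_refl_trans_1n _ level p p' ->
  subseed_equivalent (zero_subseed l p) p'.
Proof.
elim=> {p p'} [p|p p1 p2 pp1 _ [ks [ksJ ks_id]]].
  by exists [::]; split=> //; case: p => t c; apply: identified_refl.
have pull r (phi : r -> p1) : identified_via phi ->
    exists ks', {subset ks' <= zero_subseed l r} /\
      identified (mutate_along (ctrans r) ks') p2.
  move=> id_phi; have [psi id_psi phiK] := identified_via_sym id_phi.
  exists (map psi ks); split.
    move=> _ /mapP[i /ksJ ip ->]; move: ip; rewrite !inE.
    by rewrite (trop_identified l i id_psi).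
  exact: identified_trans (identified_sym (identified_along ks id_psi)) ks_id.
case: pp1 => [/identifiedP[phi id_phi]|[k k0 /identifiedP[phi id_phi]]].
  exact: pull id_phi.
have [ks' [ks'J ks'_id]] := pull _ _ id_phi.
exists (k :: ks'); split=> // i; rewrite inE => /orP[/eqP->|/ks'J].
  rewrite inE; move/eqP: k0; rewrite /scaled_trop mulf_eq0 => /orP[|//].
  by rewrite -[0]/(0%:Z) eqz_nat => /eqP m0; have := mult_gt0 k; rewrite m0.
by rewrite !inE trop_coord_mut_level.
Qed.

End FiniteType.

Theorem theorem5p8 (s : seed) (l : tropical_point s) (p q : cluster_seed s) :
  finite_type s ->
  non_negative l p ->
  non_negative l q ->
  subseed_equivalent (zero_subseed l p) q.
Proof.
move=> [n [reps reps_all]] p0 q0; apply: level_subseed_equivalent.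
have pq : conn (up l) (level l) (fun=> True) p q.
  exact: conn_trans (conn_sym (conn_base l p)) (conn_base l q).
apply: (maximal_conn (rank_bound reps l) _ _ _ _ _ pq); try exact: non_negative_maximal.
- by move=> a b; apply: up_rank.
- by move=> a b; apply: level_rank.
- by move=> a b; apply: level_sym.
- by move=> r a b; apply: up_peak.
- by move=> r a b; apply: up_cross.
Qed.
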